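(* Let $n\ge 1$ and let $H=T+V$ with $$T=\sum_{j,k=0}^{n-1}\tau_{j,k}A_j^\dagger A_k,\qquad V=\sum_{l,m=0}^{n-1}\nu_{l,m}N_lN_m,$$ where $\tau,\nu$ are complex $n\times n$ coefficient matrices such that $T$ and $V$ are Hermitian. Let $\mathscr{S}_p(t)$ be a $p$th-order product formula for $H=T+V$, and let $0\le \eta\le n$. Then there is a constant $C>0$, depending only on $p$ and on the chosen formula (and not on $n,\eta,t,\tau,\nu$), such that for all $t\ge 0$ $$\big\|\mathscr{S}_p(t)-e^{-itH}\big\|_{\eta}\le C\left(\|\tau\|+\|\nu\|_{\max}\eta\right)^{p-1}\|\tau\|\,\|\nu\|_{\max}\,\eta^2\, t^{p+1}.$$ Furthermore, if the interactions are $d$-sparse, i.e., every row and every column of $\tau$ and of $\nu$ contains at most $d$ nonzero entries, then (with $C$ again depending only on $p$ and the formula) $$\big\|\mathscr{S}_p(t)-e^{-itH}\big\|_{\eta}\le C\left(\|\tau\|_{\max}+\|\nu\|_{\max}\right)^{p-1}\|\tau\|_{\max}\|\nu\|_{\max}\, d^{p+1}\,\eta\, t^{p+1}.$$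
   Context: Fermionic Fock space on $n$ spin orbitals: the $2^n$-dimensional Hilbert space with orthonormal basis $|c_0,c_1,\dots,c_{n-1}\rangle$, $c_j\in\{0,1\}$. Creation operators: $A_j^\dagger|c_0,\dots,0_j,\dots,c_{n-1}\rangle=(-1)^{\sum_{k<j}c_k}|c_0,\dots,1_j,\dots,c_{n-1}\rangle$ and $A_j^\dagger|c_0,\dots,1_j,\dots,c_{n-1}\rangle=0$; the annihilation operator $A_j$ is the adjoint of $A_j^\dagger$. Occupation-number operators $N_j=A_j^\dagger A_j$. The $\eta$-electron subspace is spanned by basis vectors with $\sum_j c_j=\eta$; an $\eta$-electron state is a unit vector in it. For an operator $X$ commuting with $N=\sum_jN_j$, the fermionic $\eta$-seminorm is $\|X\|_\eta=\max_{|\psi_\eta\rangle,|\phi_\eta\rangle}|\langle\phi_\eta|X|\psi_\eta\rangle|$, the maximum over $\eta$-electron states. $\|\tau\|$ is the spectral norm; $\|\tau\|_{\max}=\max_{j,k}|\tau_{j,k}|$. A $p$th-order product formula is an operator $\mathscr{S}_p(t)=\prod_{\upsilon=1}^{\Upsilon}e^{-ita_\upsilon T}e^{-itb_\upsilon V}$ with fixed real coefficients $a_\upsilon,b_\upsilon$ (e.g. the Lie–Trotter formula $e^{-itT}e^{-itV}$ for $p=1$ or Suzuki formulas) such that $\mathscr{S}_p(t)=e^{-it(T+V)}+O(t^{p+1})$ as $t\to0$ for arbitrary operators $T,V$. *)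

(* Defs.v *)
(* MathComp + MathComp-Analysis, complex numbers R[i] from
   mathcomp-real-closed over an arbitrary R : realType. *)
From HB Require Import structures.
From mathcomp Require Import all_boot all_order all_algebra.
From mathcomp Require Import all_classical all_reals all_analysis.
From mathcomp Require Export complex.
Import Order.TTheory GRing.Theory Num.Theory.
Import numFieldNormedType.Exports.
Set Implicit Arguments. Unset Strict Implicit. Unset Printing Implicit Defensive.
Local Open Scope ring_scope.
Local Open Scope classical_set_scope.

Section Fock.
Variable R : realType.
Local Notation C := (R[i]).

(* modulus of a complex number, as a real number *)
Definition cnorm (z : C) : R := Num.sqrt (complex.Re z ^+ 2 + complex.Im z ^+ 2).

(* conjugate transpose *)
Definition adj (m k : nat) (X : 'M[C]_(m, k)) : 'M[C]_(k, m) :=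
  (map_mx (fun z : C => z^*) X)^T.

(* Euclidean norm of a column vector *)
Definition vnorm (m : nat) (v : 'cV[C]_m) : R :=
  Num.sqrt (\sum_(i < m) cnorm (v i 0) ^+ 2).

(* spectral norm (operator 2-norm) of a square matrix *)
Definition spec_norm (m : nat) (A : 'M[C]_m) : R :=
  sup [set r : R | exists x : 'cV[C]_m, vnorm x = 1 /\ r = vnorm (A *m x)].

(* max-entry norm *)
Definition max_norm (m : nat) (A : 'M[C]_m) : R :=
  \big[Num.max/0]_(j < m) \big[Num.max/0]_(k < m) cnorm (A j k).

(* matrix exponential, defined by its power series (limit taken entrywise
   in C with its modulus topology) *)
Definition expm (m : nat) (X : 'M[C]_m) : 'M[C]_m :=
  \matrix_(i, j) lim ((fun N : nat =>
     ((\sum_(k < N) (k`!%:R)^-1 *: X ^+ k) i j : C^o)) @ \oo).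

(* Fock space on n spin orbitals: basis index b : 'I_(2^n) encodes the
   occupation numbers c_j = j-th binary digit of b. *)
Definition occ_bit (b j : nat) : nat := odd (b %/ 2 ^ j).

(* total electron number of basis vector b *)
Definition occ_num (n b : nat) : nat := \sum_(j < n) occ_bit b j.

(* creation operator A_j^dagger; entry (r, c) = <r| A_j^dagger |c> *)
Definition Adag (n : nat) (j : 'I_n) : 'M[C]_(2 ^ n) :=
  \matrix_(r, c)
    if (occ_bit c j == 0%N) && (nat_of_ord r == (c + 2 ^ j)%N)
    then (-1) ^+ (\sum_(k < j) occ_bit c k) else 0.

(* annihilation operator: the adjoint of A_j^dagger *)
Definition Aop (n : nat) (j : 'I_n) : 'M[C]_(2 ^ n) := adj (Adag j).

(* occupation-number operator *)
Definition Nop (n : nat) (j : 'I_n) : 'M[C]_(2 ^ n) := Adag j *m Aop j.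

Definition Tham (n : nat) (tau : 'M[C]_n) : 'M[C]_(2 ^ n) :=
  \sum_(j < n) \sum_(k < n) tau j k *: (Adag j *m Aop k).

Definition Vham (n : nat) (nu : 'M[C]_n) : 'M[C]_(2 ^ n) :=
  \sum_(l < n) \sum_(m < n) nu l m *: (Nop l *m Nop m).

(* eta-electron state *)
Definition eta_state (n eta : nat) (v : 'cV[C]_(2 ^ n)) : Prop :=
  vnorm v = 1 /\ forall b : 'I_(2 ^ n), occ_num n b != eta -> v b 0 = 0.

(* fermionic eta-seminorm *)
Definition eta_seminorm (n eta : nat) (X : 'M[C]_(2 ^ n)) : R :=
  sup [set r : R | exists phi psi : 'cV[C]_(2 ^ n),
         [/\ eta_state eta phi, eta_state eta psi &
             r = cnorm ((adj phi *m X *m psi) 0 0)]].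

(* e^{-i s X} *)
Definition evol (m : nat) (s : R) (X : 'M[C]_m) : 'M[C]_m :=
  expm (- ('i%C * s%:C%C) *: X).

(* product formula prod_{u} e^{-i t a_u X} e^{-i t b_u Y} *)
Definition prod_formula (Y : nat) (a b : 'I_Y -> R) (m : nat)
    (X Z : 'M[C]_m) (t : R) : 'M[C]_m :=
  \prod_(u < Y) (evol (t * a u) X *m evol (t * b u) Z).

(* the formula is of order p: S(t) = e^{-it(X+Z)} + O(t^{p+1}) as t -> 0,
   for arbitrary operators X, Z (of any finite dimension) *)
Definition is_order (p Y : nat) (a b : 'I_Y -> R) : Prop :=
  forall (m : nat) (X Z : 'M[C]_m), exists K delta : R, 0 < delta /\
    forall t : R, `|t| <= delta -> forall i j : 'I_m,
      cnorm ((prod_formula a b X Z t - evol t (X + Z)) i j) <= K * `|t| ^+ p.+1.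

(* d-sparsity of a coefficient matrix: at most d nonzero entries per row/column *)
Definition sparse (m d : nat) (A : 'M[C]_m) : Prop :=
  (forall j : 'I_m, (#|[set k : 'I_m | A j k != 0%R]| <= d)%N) /\
  (forall k : 'I_m, (#|[set j : 'I_m | A j k != 0%R]| <= d)%N).

End Fock.

(* Main.v *)
(* Write Z_T = -iT, Z_V = -iV. The product S(t) satisfies S' = D S, where D is
   a sum of generators conjugated by partial products. Expanding these
   conjugations from the innermost exponential outwards leaves a remainder of
   order t^p in which unitaries conjugate p-fold nested commutators only; the
   lower order coefficients of D agree with those of Z_T + Z_V by the order
   condition. Hence S(t) - e^{-itH} is bounded on each invariant sector by
   t^{p+1} times the norms of the nested commutators of T and V of length p+1.

   For these, split T and V into terms indexed by pairs of sites such that terms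
   with disjoint supports commute and, for the letters T and V respectively, the
   terms touching a site have total norm of order g_T and g_V. By induction, a
   nested commutator is a sum of terms of bounded support for which the total
   norm at a site is at most a constant times the product of the rates g, so that
   eta sites give a bound eta g_T g_V (g_T + g_V)^{p-1}.

   First bound: the sites are the eta particles in first quantization, where
   T = sum_a tau^(a) and V = sum_{a,b} nu^(a,b), g_T = |tau|, g_V = |nu|_max eta.
   Sparse bound: the sites are the orbitals, the norm is the maximal column sum
   in the occupation basis, where only terms touching one of the eta occupied
   orbitals contribute to a column, g = d |.|_max; the Schur test concludes. *)

Require Import Defs.
From HB Require Import structures.
From mathcomp Require Import all_boot all_order all_algebra.
From mathcomp Require Import all_classical all_reals all_analysis.
From mathcomp Require Import complex ring lra zify.
Import Order.TTheory GRing.Theory Num.Theory.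
Import numFieldNormedType.Exports.
Set Implicit Arguments. Unset Strict Implicit. Unset Printing Implicit Defensive.
Local Open Scope ring_scope.

(** * Norms of complex vectors and matrices *)

Section ComplexNorm.
Variable R : realType.
Local Notation C := (R[i]).

(** The constants in the order condition depend on the matrices, hence on n, so they must not enter
    the estimate. The condition only yields exact identities: for the matrices at hand, the Taylor
    coefficients of [gen] below index p are H, 0, ..., 0. All constants in the final bounds then
    come from the coefficients of the formula and from counting supports. The separate factors g_T
    and g_V appear because the innermost commutator of a letter with itself vanishes, so every
    nonzero word contains both letters. A count by orbitals would produce n in place of eta. Among
    distinguishable particles the sites number eta, and a second eta enters through the rate of V,
    since a particle interacts with all the others. In the sparse case each basis state has its own
    eta occupied orbitals, so the restriction to them is possible only column by column. Mean value
    inequalities replace all integrals of matrix functions. They lose factorials, which affects only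
    the constants. *)

Lemma cnormE (z : C) : cnorm z = Normc.normc z.
Proof. by case: z. Qed.

Lemma cnorm0 : cnorm (0 : C) = 0.
Proof. by rewrite cnormE Normc.normc0. Qed.

Lemma cnorm1 : cnorm (1 : C) = 1.
Proof. by rewrite cnormE Normc.normc1. Qed.

Lemma cnormM (x y : C) : cnorm (x * y) = cnorm x * cnorm y.
Proof. by rewrite !cnormE Normc.normcM. Qed.

Lemma cnorm_ge0 (z : C) : 0 <= cnorm z.
Proof. exact: sqrtr_ge0. Qed.

Lemma cnormD (x y : C) : cnorm (x + y) <= cnorm x + cnorm y.
Proof. by rewrite !cnormE; exact: le_normcD. Qed.

Lemma cnormN (x : C) : cnorm (- x) = cnorm x.
Proof. by case: x => a b; rewrite /cnorm /= !sqrrN. Qed.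

Lemma cnorm_eq0 (z : C) : cnorm z = 0 -> z = 0.
Proof. by rewrite cnormE => /Normc.eq0_normc. Qed.

Lemma cnorm_real (r : R) : cnorm r%:C%C = `|r|.
Proof. by rewrite /cnorm /= expr0n /= addr0 sqrtr_sqr. Qed.

Lemma cnormJ (z : C) : cnorm z^* = cnorm z.
Proof. by case: z => a b; rewrite /cnorm /= sqrrN. Qed.

Lemma cnorm_i : cnorm ('i%C : C) = 1.
Proof. by rewrite /cnorm /= expr0n expr1n add0r sqrtr1. Qed.

Lemma cnormX (z : C) k : cnorm (z ^+ k) = cnorm z ^+ k.
Proof. by elim: k => [|k IH]; rewrite ?cnorm1 // !exprS cnormM IH. Qed.

Lemma cnorm_sum (I : Type) (r : seq I) (P : pred I) (F : I -> C) :
  cnorm (\sum_(i <- r | P i) F i) <= \sum_(i <- r | P i) cnorm (F i).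
Proof.
elim/big_ind2: _ => [|x1 x2 y1 y2 h1 h2|//]; first by rewrite cnorm0.
exact: le_trans (cnormD _ _) (lerD h1 h2).
Qed.

Lemma sqr_cnorm (z : C) : cnorm z ^+ 2 = complex.Re z ^+ 2 + complex.Im z ^+ 2.
Proof. by rewrite sqr_sqrtr // addr_ge0 ?sqr_ge0. Qed.

Lemma conj_mul_cnorm (z : C) : z^* * z = (cnorm z ^+ 2)%:C%C.
Proof. by case: z => a b; rewrite sqr_cnorm /=; simpc; congr (_ +i* _)%C; ring. Qed.

Lemma ReCD (x y : C) : complex.Re (x + y) = complex.Re x + complex.Re y.
Proof. by case: x y => [? ?] [? ?]. Qed.
Lemma ImCD (x y : C) : complex.Im (x + y) = complex.Im x + complex.Im y.
Proof. by case: x y => [? ?] [? ?]. Qed.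
Lemma ReCM (x y : C) : complex.Re (x * y) =
  complex.Re x * complex.Re y - complex.Im x * complex.Im y.
Proof. by case: x y => [? ?] [? ?]. Qed.
Lemma ImCM (x y : C) : complex.Im (x * y) =
  complex.Re x * complex.Im y + complex.Im x * complex.Re y.
Proof. by case: x y => [? ?] [? ?]. Qed.

Lemma ReC_sum (I : Type) (r : seq I) (P : pred I) (F : I -> C) :
  complex.Re (\sum_(i <- r | P i) F i) = \sum_(i <- r | P i) complex.Re (F i).
Proof. by apply: (big_morph (@complex.Re R)) => // x y; exact: ReCD. Qed.
Lemma ImC_sum (I : Type) (r : seq I) (P : pred I) (F : I -> C) :
  complex.Im (\sum_(i <- r | P i) F i) = \sum_(i <- r | P i) complex.Im (F i).
Proof. by apply: (big_morph (@complex.Im R)) => // x y; exact: ImCD. Qed.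

Lemma normRe_le (z : C) : `|complex.Re z| <= cnorm z.
Proof.
rewrite -(@ler_pXn2r _ 2) ?nnegrE ?cnorm_ge0 ?normr_ge0 //.
by rewrite sqr_cnorm real_normK ?num_real // lerDl sqr_ge0.
Qed.

Lemma normIm_le (z : C) : `|complex.Im z| <= cnorm z.
Proof.
rewrite -(@ler_pXn2r _ 2) ?nnegrE ?cnorm_ge0 ?normr_ge0 //.
by rewrite sqr_cnorm real_normK ?num_real // lerDr sqr_ge0.
Qed.

Lemma Re_le_cnorm (z : C) : complex.Re z <= cnorm z.
Proof. exact: le_trans (ler_norm _) (normRe_le z). Qed.

Lemma ler_sqr_wp (x y : R) : 0 <= y -> x ^+ 2 <= y ^+ 2 -> x <= y.
Proof.
move=> y0 h; case: (lerP 0 x) => [x0|/ltW x0]; last exact: le_trans x0 y0.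
by rewrite -(@ler_pXn2r _ 2).
Qed.

Lemma cauchy_schwarz_sum (I : Type) (r : seq I) (P : pred I) (f g : I -> R) :
  \sum_(i <- r | P i) f i * g i <=
  Num.sqrt (\sum_(i <- r | P i) f i ^+ 2) *
  Num.sqrt (\sum_(i <- r | P i) g i ^+ 2).
Proof.
set F := \sum_(_ <- _ | _) _ ^+ 2; set G := \sum_(_ <- _ | _) _ ^+ 2.
set S := \sum_(_ <- _ | _) _ * _.
have F0 : 0 <= F by apply: sumr_ge0 => i _; exact: sqr_ge0.
have G0 : 0 <= G by apply: sumr_ge0 => i _; exact: sqr_ge0.
have quad (x y : R) : 0 <= x ^+ 2 * F - 2 * x * y * S + y ^+ 2 * G.
  rewrite /F /G /S !mulr_sumr -sumrB -big_split /=.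
  apply: sumr_ge0 => i _; have := sqr_ge0 (x * f i - y * g i); nra.
rewrite -sqrtrM //; apply: ler_sqr_wp; first exact: sqrtr_ge0.
rewrite sqr_sqrtr ?mulr_ge0 //.
(* For F > 0 the point (S, F) gives F (F G - S^2) >= 0. For F = 0 < G the point (G, S) gives - G S^2
   >= 0, and for F = G = 0 the points (1, 1) and (1, -1) force S = 0. *)
have := quad S F; have := quad G S; have := quad G 0; have := quad 1 1.
have := quad 1 (-1).
case: (ltrP 0 F) => [Fp|Fn].
  move=> _ _ _ _ h; have : 0 <= F * (F * G - S ^+ 2) by lra.
  by rewrite pmulr_rge0 //; lra.
have -> : F = 0 by apply/le_anti; rewrite Fn F0.
move=> h1 h2 _ h3 _; case: (ltrP 0 G) => [Gp|Gn].
  by have : 0 <= G * (- (S ^+ 2)) by [lra]; rewrite pmulr_rge0 //; lra.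
have G00 : G = 0 by apply/le_anti; rewrite Gn G0.
have : S = 0 by lra.
by move=> ->; lra.
Qed.

End ComplexNorm.

Section VectorNorm.
Variable R : realType.
Local Notation C := (R[i]).

Lemma vnorm_ge0 m (v : 'cV[C]_m) : 0 <= vnorm v.
Proof. exact: sqrtr_ge0. Qed.

Lemma sqr_vnorm m (v : 'cV[C]_m) : vnorm v ^+ 2 = \sum_(i < m) cnorm (v i 0) ^+ 2.
Proof. by rewrite sqr_sqrtr // sumr_ge0 // => i _; exact: sqr_ge0. Qed.

Lemma vnorm0 m : vnorm (0 : 'cV[C]_m) = 0.
Proof. by rewrite /vnorm big1 ?sqrtr0 // => i _; rewrite mxE cnorm0 expr0n. Qed.

Lemma cnorm_le_vnorm m (v : 'cV[C]_m) i : cnorm (v i 0) <= vnorm v.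
Proof.
apply: ler_sqr_wp; first exact: vnorm_ge0.
rewrite sqr_vnorm (bigD1 i) //= lerDl.
by apply: sumr_ge0 => j _; exact: sqr_ge0.
Qed.

Lemma vnorm_eq0 m (v : 'cV[C]_m) : vnorm v = 0 -> v = 0.
Proof.
move=> v0; apply/matrixP => i j; rewrite ord1 mxE; apply: cnorm_eq0.
by apply/le_anti; rewrite cnorm_ge0 -v0 cnorm_le_vnorm.
Qed.

Lemma vnormZ m (a : C) (v : 'cV[C]_m) : vnorm (a *: v) = cnorm a * vnorm v.
Proof.
rewrite /vnorm -[X in X * _](ger0_norm (cnorm_ge0 _)) -sqrtr_sqr -sqrtrM ?sqr_ge0 //.
by congr Num.sqrt; rewrite mulr_sumr; apply: eq_bigr => i _; rewrite mxE cnormM exprMn.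
Qed.

Lemma vnormN m (v : 'cV[C]_m) : vnorm (- v) = vnorm v.
Proof. by rewrite -scaleN1r vnormZ cnormN cnorm1 mul1r. Qed.

Lemma vnormD m (u v : 'cV[C]_m) : vnorm (u + v) <= vnorm u + vnorm v.
Proof.
apply: ler_sqr_wp; first by rewrite addr_ge0 ?vnorm_ge0.
rewrite sqrrD !sqr_vnorm.
apply: (@le_trans _ _ (\sum_(i < m) (cnorm (u i 0) + cnorm (v i 0)) ^+ 2)).
  apply: ler_sum => i _; rewrite mxE ler_pXn2r ?nnegrE ?addr_ge0 ?cnorm_ge0 //.
  exact: cnormD.
under eq_bigr => i _ do rewrite sqrrD.
rewrite !big_split /= lerD2r lerD2l -mulr2n lerMn2r orFb.
exact: cauchy_schwarz_sum.
Qed.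

Lemma vnorm_sum m (I : Type) (r : seq I) (P : pred I) (F : I -> 'cV[C]_m) :
  vnorm (\sum_(i <- r | P i) F i) <= \sum_(i <- r | P i) vnorm (F i).
Proof.
elim/big_ind2: _ => [|x1 x2 y1 y2 h1 h2|//]; first by rewrite vnorm0.
exact: le_trans (vnormD _ _) (lerD h1 h2).
Qed.

Lemma adjE m k (X : 'M[C]_(m, k)) i j : adj X i j = (X j i)^*.
Proof. by rewrite !mxE. Qed.

Lemma adjM m k l (X : 'M[C]_(m, k)) (Y : 'M[C]_(k, l)) :
  adj (X *m Y) = adj Y *m adj X.
Proof. by rewrite /adj map_mxM trmx_mul. Qed.

Lemma adjD m k (X Y : 'M[C]_(m, k)) : adj (X + Y) = adj X + adj Y.
Proof. by rewrite /adj map_mxD linearD. Qed.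

Lemma adjN m k (X : 'M[C]_(m, k)) : adj (- X) = - adj X.
Proof. by rewrite /adj map_mxN linearN. Qed.

Lemma adjB m k (X Y : 'M[C]_(m, k)) : adj (X - Y) = adj X - adj Y.
Proof. by rewrite adjD adjN. Qed.

Lemma adjZ m k (a : C) (X : 'M[C]_(m, k)) : adj (a *: X) = a^* *: adj X.
Proof. by apply/matrixP => i j; rewrite !mxE rmorphM. Qed.

Lemma adjK m k (X : 'M[C]_(m, k)) : adj (adj X) = X.
Proof. by apply/matrixP => i j; rewrite !mxE conjCK. Qed.

Lemma adj_id m : adj (1%:M : 'M[C]_m) = 1%:M.
Proof. by rewrite /adj map_mx1 trmx1. Qed.

Lemma cnorm_dot m (u v : 'cV[C]_m) :
  cnorm ((adj u *m v) 0 0) <= vnorm u * vnorm v.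
Proof.
rewrite mxE; apply: le_trans (cnorm_sum _ _ _) _.
apply: le_trans (cauchy_schwarz_sum _ _ _ _); rewrite le_eqVlt; apply/orP; left.
by apply/eqP/eq_bigr => i _; rewrite cnormM adjE cnormJ.
Qed.

Lemma adj_mul_vnorm m (v : 'cV[C]_m) : (adj v *m v) 0 0 = (vnorm v ^+ 2)%:C%C.
Proof.
rewrite mxE sqr_vnorm rmorph_sum /=; apply: eq_bigr => i _.
by rewrite adjE conj_mul_cnorm.
Qed.

Lemma vnorm_isometry m k (U : 'M[C]_(k, m)) (v : 'cV[C]_m) :
  adj U *m U = 1%:M -> vnorm (U *m v) = vnorm v.
Proof.
move=> UU; apply/eqP; rewrite -(@eqrXn2 _ 2) ?vnorm_ge0 //; apply/eqP.
apply: (@complexI R); rewrite -!adj_mul_vnorm adjM mulmxA -(mulmxA (adj v)) UU.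
by rewrite mulmx1.
Qed.

Lemma vnorm_delta m (j : 'I_m) : vnorm (delta_mx j 0 : 'cV[C]_m) = 1.
Proof.
rewrite /vnorm (bigD1 j) //= big1 => [|i ij]; rewrite mxE.
  by rewrite !eqxx cnorm1 expr1n addr0 sqrtr1.
by rewrite (negbTE ij) cnorm0 expr0n.
Qed.

End VectorNorm.

(** * Derivatives of matrix functions and the mean value inequality *)

Section MatrixDerivative.
Variable R : realType.
Local Notation C := (R[i]).

Definition dR (f : R -> R) (t l : R) := is_derive t 1 f l.

Lemma dR_ext f g t l : g =1 f -> dR f t l -> dR g t l.
Proof. by move=> /funext ->. Qed.

Lemma dR_cst (c t : R) : dR (fun=> c) t 0.
Proof. exact: is_derive_cst. Qed.

Lemma dRD f g t a b : dR f t a -> dR g t b -> dR (fun s => f s + g s) t (a + b).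
Proof. by move=> ? ?; exact: is_deriveD. Qed.

Lemma dRN f t a : dR f t a -> dR (fun s => - f s) t (- a).
Proof. by move=> ?; exact: is_deriveN. Qed.

Lemma dRM f g t a b : dR f t a -> dR g t b ->
  dR (fun s => f s * g s) t (a * g t + f t * b).
Proof.
move=> df dg; rewrite /dR; apply: is_derive_eq; first exact: (is_deriveM df dg).
by rewrite /GRing.scale /= addrC mulrC.
Qed.

Lemma dRX k t : dR (fun s => s ^+ k) t (k%:R * t ^+ k.-1).
Proof.
rewrite /dR (_ : (fun s => s ^+ k) = (@id R) ^+ k); last by apply/funext => s; rewrite exprfctE.
apply: is_derive_eq.
by rewrite /GRing.scale /= mulr1.
Qed.

Definition dC (f : R -> C) (t : R) (l : C) :=
  dR (fun s => complex.Re (f s)) t (complex.Re l) /\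
  dR (fun s => complex.Im (f s)) t (complex.Im l).

Lemma dC_ext f g t l : f =1 g -> dC f t l -> dC g t l.
Proof. by move=> /funext ->. Qed.

Lemma dC_cst (c : C) t : dC (fun=> c) t 0.
Proof. by split; exact: dR_cst. Qed.

Lemma dCD f g t a b : dC f t a -> dC g t b -> dC (fun s => f s + g s) t (a + b).
Proof.
move=> [f1 f2] [g1 g2]; split.
  by apply: (dR_ext (fun s => ReCD (f s) (g s))); rewrite ReCD; exact: dRD.
by apply: (dR_ext (fun s => ImCD (f s) (g s))); rewrite ImCD; exact: dRD.
Qed.

Lemma dCM f g t a b : dC f t a -> dC g t b ->
  dC (fun s => f s * g s) t (a * g t + f t * b).
Proof.
move=> [f1 f2] [g1 g2]; split.
  apply: (dR_ext (fun s => ReCM (f s) (g s))).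
  rewrite ReCD !ReCM.
  rewrite [X in dR _ _ X](_ : _ =
    (complex.Re a * complex.Re (g t) + complex.Re (f t) * complex.Re b) +
    - (complex.Im a * complex.Im (g t) + complex.Im (f t) * complex.Im b)); last by ring.
  by apply: dRD; [|apply: dRN]; apply: dRM.
apply: (dR_ext (fun s => ImCM (f s) (g s))).
rewrite ImCD !ImCM.
rewrite [X in dR _ _ X](_ : _ =
    (complex.Re a * complex.Im (g t) + complex.Re (f t) * complex.Im b) +
    (complex.Im a * complex.Re (g t) + complex.Im (f t) * complex.Re b)); last by ring.
by apply: dRD; apply: dRM.
Qed.

Lemma dC_conj f t a : dC f t a -> dC (fun s => (f s)^*) t a^*.
Proof.
move=> [f1 f2]; have E (z : C) : complex.Re z^* = complex.Re z /\
  complex.Im z^* = - complex.Im z by case: z.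
split.
  by apply: (dR_ext (fun s => proj1 (E (f s)))); rewrite (proj1 (E _)).
by apply: (dR_ext (fun s => proj2 (E (f s)))); rewrite (proj2 (E _)); exact: dRN.
Qed.

Lemma dC_sum (I : Type) (r : seq I) (f : I -> R -> C) t (a : I -> C) :
  (forall i, dC (f i) t (a i)) ->
  dC (fun s => \sum_(i <- r) f i s) t (\sum_(i <- r) a i).
Proof.
move=> df; elim: r => [|i r IH].
  rewrite big_nil; apply: (@dC_ext (fun=> 0)); last exact: dC_cst.
  by move=> s; rewrite big_nil.
rewrite big_cons; apply: dC_ext; last exact: (dCD (df i) IH).
by move=> s; rewrite big_cons.
Qed.

Definition dM m k (F : R -> 'M[C]_(m, k)) (t : R) (L : 'M[C]_(m, k)) :=
  forall i j, dC (fun s => F s i j) t (L i j).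

Lemma dM_ext m k (F G : R -> 'M[C]_(m, k)) t L : F =1 G -> dM F t L -> dM G t L.
Proof. by move=> /funext ->. Qed.

Lemma dM_eq m k (F : R -> 'M[C]_(m, k)) t L L' : dM F t L -> L = L' -> dM F t L'.
Proof. by move=> h <-. Qed.

Lemma dM_cst m k (c : 'M[C]_(m, k)) t : dM (fun=> c) t 0.
Proof. by move=> i j; rewrite mxE; exact: dC_cst. Qed.

Lemma dMD m k (F G : R -> 'M[C]_(m, k)) t A B :
  dM F t A -> dM G t B -> dM (fun s => F s + G s) t (A + B).
Proof.
move=> dF dG i j; rewrite mxE; apply: dC_ext; last exact: (dCD (dF i j) (dG i j)).
by move=> s; rewrite mxE.
Qed.

Lemma dMM m k l (F : R -> 'M[C]_(m, k)) (G : R -> 'M[C]_(k, l)) t A B :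
  dM F t A -> dM G t B -> dM (fun s => F s *m G s) t (A *m G t + F t *m B).
Proof.
move=> dF dG i j; rewrite !mxE -big_split /=.
apply: dC_ext; last by apply: dC_sum => h; exact: (dCM (dF i h) (dG h j)).
by move=> s; rewrite mxE.
Qed.

Lemma dMMl m k l (A : 'M[C]_(m, k)) (G : R -> 'M[C]_(k, l)) t B :
  dM G t B -> dM (fun s => A *m G s) t (A *m B).
Proof.
by move=> dG; apply: dM_eq (dMM (dM_cst A t) dG) _; rewrite mul0mx add0r.
Qed.

Lemma dMMr m k l (F : R -> 'M[C]_(m, k)) (B : 'M[C]_(k, l)) t A :
  dM F t A -> dM (fun s => F s *m B) t (A *m B).
Proof.
by move=> dF; apply: dM_eq (dMM dF (dM_cst B t)) _; rewrite mulmx0 addr0.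
Qed.

Lemma dMN m k (F : R -> 'M[C]_(m, k)) t A :
  dM F t A -> dM (fun s => - F s) t (- A).
Proof.
move=> dF; rewrite -[A]mul1mx -mulNmx; apply: dM_ext (dMMl _ dF).
by move=> s; rewrite mulNmx mul1mx.
Qed.

Lemma dMB m k (F G : R -> 'M[C]_(m, k)) t A B :
  dM F t A -> dM G t B -> dM (fun s => F s - G s) t (A - B).
Proof. by move=> dF dG; exact: dMD dF (dMN dG). Qed.

Lemma dM_sum m k n (F : 'I_n -> R -> 'M[C]_(m, k)) t A :
  (forall i, dM (F i) t (A i)) -> dM (fun s => \sum_i F i s) t (\sum_i A i).
Proof.
move=> dF i j; rewrite summxE.
apply: dC_ext; last by apply: dC_sum => h; exact: (dF h i j).
by move=> s; rewrite summxE.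
Qed.

Lemma dM_adj m k (F : R -> 'M[C]_(m, k)) t A :
  dM F t A -> dM (fun s => adj (F s)) t (adj A).
Proof.
move=> dF i j; rewrite adjE; apply: dC_ext; last exact: (dC_conj (dF j i)).
by move=> s; rewrite adjE.
Qed.

Lemma dM_monomial m k q (a : C) (A : 'M[C]_(m, k)) t :
  dM (fun s => ((s ^+ q)%:C%C * a) *: A) t (((q%:R * t ^+ q.-1)%:C%C * a) *: A).
Proof.
move=> i j; rewrite mxE -mulrA.
have dX : dC (fun s => (s ^+ q)%:C%C) t (q%:R * t ^+ q.-1)%:C%C.
  by split; [exact: dRX|exact: dR_cst].
apply: dC_ext (_ : dC (fun s => (s ^+ q)%:C%C * (a * A i j)) t _).
  by move=> s; rewrite mxE mulrA.
have := dCM dX (dC_cst (a * A i j) t).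
by rewrite mulr0 addr0.
Qed.

(** A norm bound on the fixed space of P. In the final estimates P projects onto an electron sector;
    P = 1 gives an ordinary operator bound. *)
Definition opb m (P X : 'M[C]_m) (K : R) :=
  forall v : 'cV[C]_m, P *m v = v -> vnorm (X *m v) <= K * vnorm v.

Lemma re_mvt (g g' : R -> R) (t : R) : 0 <= t ->
  (forall s, 0 <= s <= t -> dR g s (g' s)) ->
  exists2 c, 0 <= c <= t & g t - g 0 = g' c * t.
Proof.
move=> t0 dg.
have dg1 s : s \in `[0, t] -> is_derive s 1 g (g' s) by rewrite in_itv; exact: dg.
have dg2 s : s \in `]0, t[ -> is_derive s 1 g (g' s).
  by rewrite in_itv /= => /andP[s0 st]; apply: dg; rewrite !ltW.
have [|c] := @MVT_segment R g g' 0 t t0 dg2.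
  apply: derivable_within_continuous => x /dg1 dx; exact: (@ex_derive _ _ _ _ _ _ _ dx).
by rewrite subr0 in_itv /= => ? ?; exists c.
Qed.

(* Mean value theorem for the real function [Re <F t v, F s v>]. *)
Lemma mvt_opb m (P : 'M[C]_m) (F F' : R -> 'M[C]_m) (r : nat) (K t : R) :
  0 <= t -> 0 <= K -> F 0 = 0 ->
  (forall s, 0 <= s <= t -> dM F s (F' s)) ->
  (forall s, 0 <= s <= t -> opb P (F' s) (K * s ^+ r)) ->
  opb P (F t) (K * t ^+ r.+1).
Proof.
move=> t0 K0 F0 dF bF v Pv.
set w := F t *m v.
have dg s : 0 <= s <= t -> dR (fun s => complex.Re ((adj w *m (F s *m v)) 0 0)) s
   (complex.Re ((adj w *m (F' s *m v)) 0 0)).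
  by move=> /dF dFs; exact: (proj1 (dMMl (adj w) (dMMr v dFs) 0 0)).
have [c /andP[c0 ct]] := re_mvt t0 dg.
have Z0 : complex.Re ((0 : 'M[C]_1) 0 0) = 0 by rewrite mxE.
rewrite F0 mul0mx mulmx0 Z0 subr0 -/w adj_mul_vnorm /= => E.
case: (eqVneq (vnorm w) 0) => [->|w0].
  by rewrite !mulr_ge0 ?vnorm_ge0 ?exprn_ge0.
have wp : 0 < vnorm w by rewrite lt_def w0 vnorm_ge0.
rewrite -(ler_pM2l wp) -expr2 E exprS.
apply: (@le_trans _ _ (vnorm w * (K * t ^+ r * vnorm v) * t)); last first.
  by rewrite le_eqVlt; apply/orP; left; apply/eqP; ring.
apply: ler_wpM2r => //.
apply: le_trans (Re_le_cnorm _) _; apply: le_trans (cnorm_dot _ _) _.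
apply: ler_wpM2l; first exact: vnorm_ge0.
apply: le_trans (bF c _ v Pv) _; first by rewrite c0 ct.
apply: ler_wpM2r; first exact: vnorm_ge0.
by apply: ler_wpM2l => //; apply: lerXn2r.
Qed.

Lemma opb_eq0 m (X : 'M[C]_m) : opb 1%:M X 0 -> X = 0.
Proof.
move=> h; apply/matrixP => i j; rewrite mxE.
have /eqP := h (delta_mx j 0) (mul1mx _).
rewrite mul0r => /eqP; rewrite -colE => le0.
have : vnorm (col j X) = 0 by apply/le_anti; rewrite le0 vnorm_ge0.
by move=> /vnorm_eq0 /matrixP /(_ i 0); rewrite !mxE.
Qed.

(** The mean value inequality with K = 0. The algebraic facts about exponentials below come from
    exhibiting constant functions, hence their restriction to t >= 0. *)
Lemma dM_const m (F : R -> 'M[C]_m) (t : R) :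
  0 <= t -> (forall s, dM F s 0) -> F t = F 0.
Proof.
move=> t0 dF; apply/eqP; rewrite -subr_eq0; apply/eqP/opb_eq0.
rewrite -[X in opb _ _ X](mul0r (t ^+ 1)).
apply: (@mvt_opb _ _ (fun s => F s - F 0) (fun=> 0) 0) => //.
- by rewrite subrr.
- by move=> s _; apply: dM_eq (dMB (dF s) (dM_cst (F 0) s)) _; rewrite subr0.
- by move=> s _ v _; rewrite mul0mx vnorm0 mul0r mul0r.
Qed.

Lemma opb_le m (P X : 'M[C]_m) K L : K <= L -> opb P X K -> opb P X L.
Proof.
by move=> KL h v Pv; apply: le_trans (h v Pv) _; apply: ler_wpM2r KL; exact: vnorm_ge0.
Qed.

Lemma opb0 m (P : 'M[C]_m) K : 0 <= K -> opb P 0 K.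
Proof. by move=> K0 v _; rewrite mul0mx vnorm0 mulr_ge0 ?vnorm_ge0. Qed.

Lemma opbD m (P X Y : 'M[C]_m) K L : opb P X K -> opb P Y L -> opb P (X + Y) (K + L).
Proof.
move=> hX hY v Pv; rewrite mulmxDl mulrDl.
exact: le_trans (vnormD _ _) (lerD (hX v Pv) (hY v Pv)).
Qed.

Lemma opbN m (P X : 'M[C]_m) K : opb P X K -> opb P (- X) K.
Proof. by move=> hX v Pv; rewrite mulNmx vnormN; exact: hX. Qed.

Lemma opbB m (P X Y : 'M[C]_m) K L : opb P X K -> opb P Y L -> opb P (X - Y) (K + L).
Proof. by move=> hX /opbN; exact: opbD. Qed.

Lemma opbZ m (P X : 'M[C]_m) (a : C) K : opb P X K -> opb P (a *: X) (cnorm a * K).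
Proof.
move=> hX v Pv; rewrite -scalemxAl vnormZ -mulrA.
by apply: ler_wpM2l (hX v Pv); exact: cnorm_ge0.
Qed.

Lemma opb_sum m (P : 'M[C]_m) n (X : 'I_n -> 'M[C]_m) (K : 'I_n -> R) :
  (forall i, opb P (X i) (K i)) -> opb P (\sum_i X i) (\sum_i K i).
Proof.
move=> h v Pv; rewrite mulmx_suml mulr_suml.
by apply: le_trans (vnorm_sum _ _ _) _; apply: ler_sum => i _; exact: h.
Qed.

(** Commutation of Y with P keeps Y v in the fixed space of P, where the bound on X applies. *)
Lemma opbM m (P X Y : 'M[C]_m) K L : 0 <= K -> P *m Y = Y *m P ->
  opb P X K -> opb P Y L -> opb P (X *m Y) (K * L).
Proof.
move=> K0 PY hX hY v Pv; rewrite -mulmxA -mulrA.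
apply: le_trans (hX _ _) _; first by rewrite mulmxA PY -mulmxA Pv.
by apply: ler_wpM2l (hY v Pv).
Qed.

Lemma opb_isometry m (P U : 'M[C]_m) : adj U *m U = 1%:M -> opb P U 1.
Proof. by move=> UU v _; rewrite vnorm_isometry // mul1r. Qed.

(** Turns the entrywise order condition into an operator bound. The dimension factor is harmless
    because that bound is used only qualitatively. *)
Lemma opb_entries m (P X : 'M[C]_m) K : 0 <= K ->
  (forall i j, cnorm (X i j) <= K) -> opb P X (m%:R ^+ 2 * K).
Proof.
move=> K0 hX v _.
have h1 i : cnorm ((X *m v) i 0) <= m%:R * (K * vnorm v).
  rewrite mxE; apply: le_trans (cnorm_sum _ _ _) _.
  rewrite mulrC -[X in _ * X%:R]card_ord -sumr_const mulr_sumr.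
  apply: ler_sum => j _; rewrite mulr1 cnormM.
  by rewrite ler_pM ?cnorm_ge0 ?cnorm_le_vnorm.
have hK : 0 <= m%:R * (K * vnorm v) by rewrite !mulr_ge0 ?vnorm_ge0 ?ler0n.
apply: ler_sqr_wp; first by rewrite !mulr_ge0 ?vnorm_ge0 ?exprn_ge0 ?ler0n.
rewrite sqr_vnorm.
apply: (@le_trans _ _ (\sum_(i < m) (m%:R * (K * vnorm v)) ^+ 2)).
  by apply: ler_sum => i _; rewrite lerXn2r ?nnegrE ?cnorm_ge0.
rewrite sumr_const card_ord -[leLHS]mulr_natl.
have [M0|M1] : m%:R = 0 :> R \/ 1 <= m%:R :> R.
- by case: (m) => [|m']; [left|right; rewrite ler1n].
- by rewrite M0 mul0r sqr_ge0.
move: M1 hK; set M := m%:R; set k := K * _ => M1 hK.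
rewrite -!mulrA -/k.
rewrite [leRHS](_ : _ = M * (M * (M * k) ^+ 2)); last by ring.
have M0 : 0 <= M by rewrite ler0n.
by rewrite ler_wpM2l // ler_peMl //; exact: sqr_ge0.
Qed.

Lemma opb_bounded m (P X : 'M[C]_m) : exists2 K : R, 0 <= K & opb P X K.
Proof.
pose K := \sum_i \sum_j cnorm (X i j).
have K0 : 0 <= K by apply: sumr_ge0 => i _; apply: sumr_ge0 => j _; exact: cnorm_ge0.
exists (m%:R ^+ 2 * K); first by rewrite mulr_ge0 ?exprn_ge0 ?ler0n.
apply: opb_entries => // i j; rewrite /K (bigD1 i) //= (bigD1 j) //= -addrA lerDl.
rewrite addr_ge0 ?sumr_ge0 // => [k _|k _]; first exact: cnorm_ge0.
by rewrite sumr_ge0 // => l _; exact: cnorm_ge0.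
Qed.

End MatrixDerivative.

(** * The matrix exponential *)

Section MatrixExponential.
Variable R : realType.
Local Notation C := (R[i]).
Local Open Scope classical_set_scope.

Lemma cnorm_le_ReIm (z : C) : cnorm z <= `|complex.Re z| + `|complex.Im z|.
Proof.
apply: ler_sqr_wp; first by rewrite addr_ge0.
rewrite sqr_cnorm sqrrD !real_normK ?num_real // -addrA (addrC (_ *+ 2)) addrA.
by rewrite lerDl mulrn_wge0 // mulr_ge0.
Qed.

Lemma cvg_complex (u : nat -> C) (z : C) :
  (fun N => complex.Re (u N)) @ \oo --> complex.Re z ->
  (fun N => complex.Im (u N)) @ \oo --> complex.Im z ->
  (fun N => u N : C^o) @ \oo --> (z : C^o).
Proof.
move=> hr hi; apply/cvgrPdist_lt => eps eps0.
have [e -> e0] : exists2 e : R, eps = e%:C%C & 0 < e.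
  move: eps eps0 => [e f]; rewrite ltcE /= => /andP[/eqP f0 e0].
  by exists e => //; rewrite f0.
have e20 : 0 < e / 2 by rewrite divr_gt0.
move/cvgrPdist_lt: hr => /(_ _ e20) hr; move/cvgrPdist_lt: hi => /(_ _ e20) hi.
near=> N.
rewrite normc_def ltcR -/(cnorm _).
apply: le_lt_trans (cnorm_le_ReIm _) _.
rewrite (splitr e); apply: ltrD.
  rewrite (_ : complex.Re _ = complex.Re z - complex.Re (u N)); first by near: N.
  by case: (z) (u N) => [? ?] [? ?].
rewrite (_ : complex.Im _ = complex.Im z - complex.Im (u N)); first by near: N.
by case: (z) (u N) => [? ?] [? ?].
Unshelve. all: by end_near. Qed.

Definition cvgC (u : nat -> C) (z : C) :=
  ((fun N => complex.Re (u N)) @ \oo --> complex.Re z) /\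
  ((fun N => complex.Im (u N)) @ \oo --> complex.Im z).

Lemma cvgC_ext u v z : u =1 v -> cvgC u z -> cvgC v z.
Proof. by move=> /funext ->. Qed.

Lemma cvgC_unique u z w : cvgC u z -> cvgC u w -> z = w.
Proof.
move=> [h1 h2] [h3 h4]; apply/eqP; rewrite eq_complex.
by rewrite (cvg_unique _ h1 h3) ?(cvg_unique _ h2 h4) ?eqxx //; exact: Rhausdorff.
Qed.

Lemma cvgC_cst z : cvgC (fun=> z) z.
Proof. by split; exact: cvg_cst. Qed.

Lemma cvgCD u v z w : cvgC u z -> cvgC v w -> cvgC (fun N => u N + v N) (z + w).
Proof.
move=> [u1 u2] [v1 v2]; split.
  rewrite (_ : (fun _ => _) = (fun N => complex.Re (u N) + complex.Re (v N))).
    by rewrite ReCD; exact: cvgD u1 v1.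
  by apply/funext => N; rewrite ReCD.
rewrite (_ : (fun _ => _) = (fun N => complex.Im (u N) + complex.Im (v N))).
  by rewrite ImCD; exact: cvgD u2 v2.
by apply/funext => N; rewrite ImCD.
Qed.

Lemma cvgCM u v z w : cvgC u z -> cvgC v w -> cvgC (fun N => u N * v N) (z * w).
Proof.
move=> [u1 u2] [v1 v2]; split.
  rewrite (_ : (fun _ => _) = (fun N => complex.Re (u N) * complex.Re (v N)
      - complex.Im (u N) * complex.Im (v N))).
    by rewrite ReCM; apply: cvgB; apply: cvgM.
  by apply/funext => N; rewrite ReCM.
rewrite (_ : (fun _ => _) = (fun N => complex.Re (u N) * complex.Im (v N)
      + complex.Im (u N) * complex.Re (v N))).
  by rewrite ImCM; apply: cvgD; apply: cvgM.
by apply/funext => N; rewrite ImCM.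
Qed.

Lemma cvgC_sum (I : Type) (r : seq I) (u : I -> nat -> C) (z : I -> C) :
  (forall i, cvgC (u i) (z i)) ->
  cvgC (fun N => \sum_(i <- r) u i N) (\sum_(i <- r) z i).
Proof.
move=> h; elim: r => [|i r IH].
  rewrite big_nil; apply: (@cvgC_ext (fun=> 0)); last exact: cvgC_cst.
  by move=> s; rewrite big_nil.
rewrite big_cons; apply: cvgC_ext; last exact: (cvgCD (h i) IH).
by move=> s; rewrite big_cons.
Qed.

Lemma is_cvg_pseries_exp_bound (a : nat -> R) (D B K : R) : 0 <= D -> 0 <= B ->
  (forall k, `|a k| <= D * (B ^+ k / k`!%:R)) -> cvgn (pseries a K).
Proof.
move=> D0 B0 ha; apply: normed_cvg.
have := is_cvg_seriesZ (k := D) (is_cvg_series_exp_coeff (B * `|K|)).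
apply: series_le_cvg => k //=.
  by rewrite mulr_ge0 // divr_ge0 ?ler0n // exprn_ge0 // mulr_ge0.
rewrite [leRHS](_ : _ = D * ((B * `|K|) ^+ k / k`!%:R)) //.
rewrite normrM normrX exprMn [_ * _ / _]mulrAC mulrA.
by apply: ler_wpM2r => //; rewrite exprn_ge0.
Qed.

(** Coefficients of size D B^k / k! are stable under formal differentiation, with D replaced by D B;
    [is_derive_pseries] differentiates twice. *)
Lemma pseries_diffs_bound (a : nat -> R) (D B : R) :
  (forall k, `|a k| <= D * (B ^+ k / k`!%:R)) ->
  forall k, `|pseries_diffs a k| <= (D * B) * (B ^+ k / k`!%:R).
Proof.
move=> ha k; rewrite /pseries_diffs normrM ger0_norm ?ler0n //.
apply: le_trans (ler_wpM2l (ler0n _ _) (ha k.+1)) _.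
rewrite factS natrM invfM exprS le_eqVlt; apply/orP; left; apply/eqP.
have n0 : k.+1%:R != 0 :> R by rewrite pnatr_eq0.
have f0 : k`!%:R != 0 :> R by rewrite pnatr_eq0 -lt0n fact_gt0.
by field; rewrite f0 nat1r.
Qed.

Lemma is_derive_pseries (a : nat -> R) (D B t : R) : 0 <= D -> 0 <= B ->
  (forall k, `|a k| <= D * (B ^+ k / k`!%:R)) ->
  dR (fun s => limn (pseries a s)) t (limn (pseries (pseries_diffs a) t)).
Proof.
move=> D0 B0 ha.
have ha1 := pseries_diffs_bound ha; have ha2 := pseries_diffs_bound ha1.
have DB0 : 0 <= D * B by rewrite mulr_ge0.
have DBB0 : 0 <= D * B * B by rewrite mulr_ge0.
(* Term-by-term differentiation asks for convergence of the series and of its first two formal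
   derivatives at some radius beyond |t|; here every radius is admissible. *)
apply: (@pseries_snd_diffs _ _ (`|t| + 1)).
- exact: is_cvg_pseries_exp_bound ha.
- exact: is_cvg_pseries_exp_bound ha1.
- exact: is_cvg_pseries_exp_bound ha2.
- by rewrite [ltRHS]ger0_norm ?addr_ge0 // ltrDl.
Qed.

Variable m : nat.
Implicit Type X : 'M[C]_m.

Fact expt_key : unit. Proof. exact: tt. Qed.

(* Locked, since unfolding the limit makes unification diverge. *)
Definition expt X (t : R) : 'M[C]_m := locked_with expt_key (expm (t%:C%C *: X)).

Lemma expt_expm X (t : R) : expt X t = expm (t%:C%C *: X).
Proof. by rewrite /expt unlock. Qed.

Definition expt_partial X t N : 'M[C]_m :=
  \sum_(k < N) (t%:C%C ^+ k / k`!%:R) *: X ^+ k.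

Lemma mx_exprZ (c : C) X k : (c *: X) ^+ k = c ^+ k *: X ^+ k.
Proof.
elim: k => [|k IH]; first by rewrite !expr0 scale1r.
by rewrite !exprS IH /GRing.mul /= -scalemxAl -scalemxAr scalerA.
Qed.

Lemma mx_expr_bound X : exists2 B : R, 0 <= B &
  forall k i j, cnorm ((X ^+ k) i j) <= B ^+ k.
Proof.
pose B := \sum_i \sum_j cnorm (X i j).
have B0 : 0 <= B by apply: sumr_ge0 => i _; apply: sumr_ge0 => j _; exact: cnorm_ge0.
exists B => // k; elim: k => [|k IH] i j.
  by rewrite !expr0 mxE; case: (i == j); rewrite ?cnorm1 ?cnorm0.
rewrite !exprS [X in cnorm X]mxE; apply: le_trans (cnorm_sum _ _ _) _.
apply: (@le_trans _ _ (\sum_l cnorm (X i l) * B ^+ k)).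
  by apply: ler_sum => l _; rewrite cnormM; apply: ler_wpM2l (IH _ _); exact: cnorm_ge0.
rewrite -mulr_suml; apply: ler_wpM2r; first exact: exprn_ge0.
rewrite /B [leRHS](bigD1 i) //= lerDl.
by apply: sumr_ge0 => l _; apply: sumr_ge0 => h _; exact: cnorm_ge0.
Qed.

Definition coefR X i j k : R := complex.Re ((X ^+ k) i j) / k`!%:R.
Definition coefI X i j k : R := complex.Im ((X ^+ k) i j) / k`!%:R.

Lemma coef_bound X : exists2 B : R, 0 <= B & forall i j k,
  `|coefR X i j k| <= 1 * (B ^+ k / k`!%:R) /\
  `|coefI X i j k| <= 1 * (B ^+ k / k`!%:R).
Proof.
have [B B0 hB] := mx_expr_bound X; exists B => // i j k.
rewrite mul1r !normrM [`|_^-1|]ger0_norm ?invr_ge0 ?ler0n //.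
split; apply: ler_wpM2r; rewrite ?invr_ge0 ?ler0n //.
  exact: le_trans (normRe_le _) (hB _ _ _).
exact: le_trans (normIm_le _) (hB _ _ _).
Qed.

Lemma ReC_scale (r : R) (z : C) : complex.Re (r%:C%C * z) = r * complex.Re z.
Proof. by rewrite ReCM /= mul0r subr0. Qed.

Lemma ImC_scale (r : R) (z : C) : complex.Im (r%:C%C * z) = r * complex.Im z.
Proof. by rewrite ImCM /= mul0r addr0. Qed.

Lemma real_coef (t : R) k : (t%:C%C ^+ k / k`!%:R : C) = (t ^+ k / k`!%:R)%:C%C.
Proof. by rewrite rmorphM rmorphXn fmorphV rmorph_nat. Qed.

Lemma expt_partialE X t N i j : expt_partial X t N i j =
  (pseries (coefR X i j) t N +i* pseries (coefI X i j) t N)%C.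
Proof.
rewrite /expt_partial summxE /pseries /series /= !big_mkord.
apply/eqP; rewrite eq_complex ReC_sum ImC_sum /=; apply/andP; split; apply/eqP.
  by apply: eq_bigr => k _; rewrite mxE real_coef ReC_scale /coefR; ring.
by apply: eq_bigr => k _; rewrite mxE real_coef ImC_scale /coefI; ring.
Qed.

Lemma cvg_expt_partial X t i j : cvgC (fun N => expt_partial X t N i j)
  (limn (pseries (coefR X i j) t) +i* limn (pseries (coefI X i j) t))%C.
Proof.
have [B B0 hB] := coef_bound X.
have hr := is_cvg_pseries_exp_bound (K := t) ler01 B0 (fun k => proj1 (hB i j k)).
have hi := is_cvg_pseries_exp_bound (K := t) ler01 B0 (fun k => proj2 (hB i j k)).
by split; under eq_fun do rewrite expt_partialE.
Qed.

Lemma exptE X t i j : expt X t i j =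
  (limn (pseries (coefR X i j) t) +i* limn (pseries (coefI X i j) t))%C.
Proof.
have [h1 h2] := cvg_expt_partial X t i j; have h := cvg_complex h1 h2.
rewrite -(cvg_lim (@norm_hausdorff _ _) h) expt_expm /expm mxE.
apply: (congr1 (fun f : nat -> C^o => lim (f @ \oo))).
apply/funext => N; congr (fun_of_matrix _ i j).
by apply: eq_bigr => k _; rewrite mx_exprZ scalerA mulrC.
Qed.

Lemma cvg_expt X t i j : cvgC (fun N => expt_partial X t N i j) (expt X t i j).
Proof. rewrite exptE; exact: cvg_expt_partial. Qed.

(** Differentiation turns 1 / (k + 1)! into 1 / k! and leaves X^(k+1) in the k-th term. Splitting
    off one X on the left or on the right gives the two forms of the derivative. *)
Lemma expt_diffs X t (L : 'M[C]_m) i j :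
  cvgC (fun N => (\sum_(k < N) (t%:C%C ^+ k / k`!%:R) *: X ^+ k.+1) i j) (L i j) ->
  dC (fun s => expt X s i j) t (L i j).
Proof.
move=> cv; have [B B0 hB] := coef_bound X.
have hr1 k := proj1 (hB i j k); have hi1 k := proj2 (hB i j k).
suff -> : L i j = (limn (pseries (pseries_diffs (coefR X i j)) t) +i*
                   limn (pseries (pseries_diffs (coefI X i j)) t))%C.
  split.
    apply: (dR_ext (fun s => congr1 (@complex.Re R) (exptE X s i j))).
    exact: is_derive_pseries hr1.
  apply: (dR_ext (fun s => congr1 (@complex.Im R) (exptE X s i j))).
  exact: is_derive_pseries hi1.
apply: cvgC_unique cv _.
have hf k : k.+1%:R / k.+1`!%:R = (k`!%:R)^-1 :> R.
  have n0 : k.+1%:R != 0 :> R by rewrite pnatr_eq0.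
  have f0 : k`!%:R != 0 :> R by rewrite pnatr_eq0 -lt0n fact_gt0.
  by rewrite factS natrM; field; rewrite f0 nat1r n0.
split.
  rewrite (_ : (fun N => _) = pseries (pseries_diffs (coefR X i j)) t).
    apply: is_cvg_pseries_exp_bound (pseries_diffs_bound hr1) => //.
    by rewrite mulr_ge0.
  apply/funext => N; rewrite /pseries /series /= big_mkord summxE ReC_sum.
  apply: eq_bigr => k _; rewrite mxE real_coef ReC_scale /pseries_diffs /coefR.
  rewrite -hf; ring.
rewrite (_ : (fun N => _) = pseries (pseries_diffs (coefI X i j)) t).
  apply: is_cvg_pseries_exp_bound (pseries_diffs_bound hi1) => //.
  by rewrite mulr_ge0.
apply/funext => N; rewrite /pseries /series /= big_mkord summxE ImC_sum.
apply: eq_bigr => k _; rewrite mxE real_coef ImC_scale /pseries_diffs /coefI.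
rewrite -hf; ring.
Qed.

Lemma dM_exptl X t : dM (expt X) t (X *m expt X t).
Proof.
move=> i j; apply: expt_diffs.
apply: (@cvgC_ext (fun N => \sum_l X i l * expt_partial X t N l j)); last first.
  by rewrite mxE; apply: cvgC_sum => l; exact: (cvgCM (cvgC_cst _) (cvg_expt _ _ _ _)).
move=> N; transitivity ((X *m expt_partial X t N) i j); first by rewrite mxE.
congr (fun_of_matrix _ i j); rewrite /expt_partial mulmx_sumr.
by apply: eq_bigr => k _; rewrite -scalemxAr exprS.
Qed.

Lemma dM_exptr X t : dM (expt X) t (expt X t *m X).
Proof.
move=> i j; apply: expt_diffs.
apply: (@cvgC_ext (fun N => \sum_l expt_partial X t N i l * X l j)); last first.
  by rewrite mxE; apply: cvgC_sum => l; exact: (cvgCM (cvg_expt _ _ _ _) (cvgC_cst _)).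
move=> N; transitivity ((expt_partial X t N *m X) i j); first by rewrite mxE.
congr (fun_of_matrix _ i j); rewrite /expt_partial mulmx_suml.
by apply: eq_bigr => k _; rewrite -scalemxAl exprSr.
Qed.

Lemma expt_0 X : expt X 0 = 1%:M.
Proof.
apply/matrixP => i j; apply: cvgC_unique (cvg_expt X 0 i j) _.
(* The empty partial sum is 0, so the sequence is constant only from index 1 on. *)
suff h N : expt_partial X 0 N.+1 = 1%:M.
  split; rewrite -cvg_shiftS /=.
    by under eq_fun do rewrite h; exact: cvg_cst.
  by under eq_fun do rewrite h; exact: cvg_cst.
rewrite /expt_partial big_ord_recl big1 => [|k _].
  by rewrite addr0 !expr0 fact0 divr1 scale1r.
by rewrite rmorph0 expr0n mul0r scale0r.
Qed.

Lemma expt_inv X (t : R) : 0 <= t -> expt (- X) t *m expt X t = 1%:M.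
Proof.
move=> t0; pose F s := expt (- X) s *m expt X s.
have F' u : dM F u 0.
  apply: dM_eq (dMM (dM_exptr _ u) (dM_exptl _ u)) _.
  by rewrite mulmxN mulNmx mulmxA addNr.
by have := dM_const t0 F'; rewrite /F !expt_0 mulmx1.
Qed.

(** e^{tX} P e^{-tX} has zero derivative, hence equals P; multiplying by e^{tX} on the right gives
    the claim. *)
Lemma expt_comm (X P : 'M[C]_m) (t : R) : 0 <= t ->
  P *m X = X *m P -> P *m expt X t = expt X t *m P.
Proof.
move=> t0 PX; pose F s := expt X s *m P *m expt (- X) s.
have F' u : dM F u 0.
  apply: dM_eq (dMM (dMMr P (dM_exptr _ u)) (dM_exptl _ u)) _.
  by rewrite -!mulmxA mulNmx !mulmxN (mulmxA X P) -PX -mulmxA addrN.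
have h : expt X t *m P *m expt (- X) t = P.
  by have := dM_const t0 F'; rewrite /F !expt_0 mulmx1 mul1mx.
have e1 := congr1 (mulmx^~ (expt X t)) h.
have := congr1 (mulmx (expt X t *m P)) (expt_inv X t0).
by rewrite mulmx1 mulmxA -e1.
Qed.

Lemma expt_unitary X (t : R) : 0 <= t -> adj X = - X ->
  adj (expt X t) *m expt X t = 1%:M.
Proof.
move=> t0 aX; pose F s := adj (expt X s) *m expt X s.
have F' u : dM F u 0.
  apply: dM_eq (dMM (dM_adj (dM_exptl _ u)) (dM_exptl _ u)) _.
  by rewrite adjM aX mulmxN mulNmx mulmxA addNr.
by have := dM_const t0 F'; rewrite /F expt_0 adj_id mulmx1.
Qed.

End MatrixExponential.

(** * Product formula error from nested commutators *)

Section Commutators.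
Variable R : realType.
Local Notation C := (R[i]).
Variable m : nat.
Implicit Types X Y M P : 'M[C]_m.

Definition commx X Y : 'M[C]_m := X *m Y - Y *m X.

Lemma commxD X Y M : commx X (Y + M) = commx X Y + commx X M.
Proof. by rewrite /commx mulmxDr mulmxDl opprD addrACA. Qed.

Lemma commx0 X : commx X 0 = 0.
Proof. by rewrite /commx mulmx0 mul0mx subr0. Qed.

Lemma commxx X : commx X X = 0.
Proof. exact: subrr. Qed.

Lemma commxZr X (a : C) Y : commx X (a *: Y) = a *: commx X Y.
Proof. by rewrite /commx -scalemxAr -scalemxAl scalerBr. Qed.

Lemma commxZl X (a : C) Y : commx (a *: X) Y = a *: commx X Y.
Proof. by rewrite /commx -scalemxAr -scalemxAl scalerBr. Qed.

Lemma comm_mx_commx P X Y : P *m X = X *m P -> P *m Y = Y *m P ->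
  P *m commx X Y = commx X Y *m P.
Proof.
move=> hX hY; rewrite /commx mulmxBr mulmxBl !mulmxA hX hY -!mulmxA hX hY.
by [].
Qed.

Lemma comm_mx_iter P X Y r : P *m X = X *m P -> P *m Y = Y *m P ->
  P *m iter r (commx X) Y = iter r (commx X) Y *m P.
Proof. by move=> hX hY; elim: r => //= r IH; exact: comm_mx_commx. Qed.

Lemma comm_mx_scale P (a : C) X : P *m X = X *m P -> P *m (a *: X) = (a *: X) *m P.
Proof. by move=> h; rewrite -scalemxAr h scalemxAl. Qed.

Lemma comm_mx_add P X Y : P *m X = X *m P -> P *m Y = Y *m P ->
  P *m (X + Y) = (X + Y) *m P.
Proof. by move=> h1 h2; rewrite mulmxDr mulmxDl h1 h2. Qed.

Lemma comm_mx_sub P X Y : P *m X = X *m P -> P *m Y = Y *m P ->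
  P *m (X - Y) = (X - Y) *m P.
Proof. by move=> h1 h2; rewrite mulmxBr mulmxBl h1 h2. Qed.

Lemma comm_mx_bigsum P n (F : 'I_n -> 'M[C]_m) :
  (forall i, P *m F i = F i *m P) -> P *m (\sum_i F i) = (\sum_i F i) *m P.
Proof. by move=> h; rewrite mulmx_sumr mulmx_suml; apply: eq_bigr => i _. Qed.

Lemma comm_mx_mul P X Y : P *m X = X *m P -> P *m Y = Y *m P ->
  P *m (X *m Y) = (X *m Y) *m P.
Proof. by move=> h1 h2; rewrite mulmxA h1 -!mulmxA h2. Qed.

Fixpoint adw (Z : bool -> 'M[C]_m) (w : seq bool) M : 'M[C]_m :=
  if w is b :: w' then commx (Z b) (adw Z w' M) else M.

Lemma adw_rcons Z w b M : adw Z (rcons w b) M = adw Z w (commx (Z b) M).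
Proof. by elim: w => //= c w ->. Qed.

Lemma adwD Z w M N : adw Z w (M + N) = adw Z w M + adw Z w N.
Proof. by elim: w => //= b w ->; rewrite commxD. Qed.

Lemma adwZ Z w a M : adw Z w (a *: M) = a *: adw Z w M.
Proof. by elim: w => //= b w ->; rewrite commxZr. Qed.

Lemma adw0 Z w : adw Z w 0 = 0.
Proof. by elim: w => //= b w ->; rewrite commx0. Qed.

Lemma iter_commxZ Z (c : C) b r M :
  iter r (commx (c *: Z b)) M = c ^+ r *: adw Z (nseq r b) M.
Proof.
elim: r => [|r IH] /=; first by rewrite expr0 scale1r.
by rewrite IH commxZl commxZr scalerA exprS.
Qed.

End Commutators.

(** * Taylor expansion of the generator and the error of the product formula *)

Section TrotterError.
Variable R : realType.
Local Notation C := (R[i]).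

(** Both sides run over the pairs of indices with sum less than p, once by antidiagonals and once by
    rows. *)
Lemma sum_triangle (V : zmodType) (f : nat -> nat -> V) p :
  \sum_(q < p) \sum_(r < q.+1) f (q - r)%N r = \sum_(q < p) \sum_(r < p - q) f q r.
Proof.
elim: p => [|p IH]; first by rewrite !big_ord0.
rewrite big_ord_recr /= {}IH [RHS]big_ord_recr /= subSnn big_ord1.
have -> : \sum_(i < p) \sum_(r < p.+1 - i) f i r =
  \sum_(i < p) \sum_(r < p - i) f i r + \sum_(i < p) f i (p - i)%N.
  rewrite -big_split /=; apply: eq_bigr => i _.
  by rewrite subSn ?big_ord_recr //= ltnW.
rewrite -addrA; congr (_ + _).
rewrite (reindex_inj rev_ord_inj) /= big_ord_recr /= !subSS subnn subn0.
congr (_ + _); apply: eq_bigr => i _.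
by rewrite subSS subKn // ltnW.
Qed.

Section Fixed.
Variables (m : nat) (P : 'M[C]_m) (Z : bool -> 'M[C]_m).
Hypothesis PZ : forall b, P *m Z b = Z b *m P.
Hypothesis antiZ : forall b, adj (Z b) = - Z b.

Section OneStep.
Variable X : 'M[C]_m.
Hypothesis PX : P *m X = X *m P.
Hypothesis antiX : adj X = - X.

Lemma comm_mx_opp : P *m (- X) = (- X) *m P.
Proof. by rewrite mulmxN mulNmx PX. Qed.

Lemma adj_opp : adj (- X) = - - X.
Proof. by rewrite adjN antiX. Qed.

Definition Adx (t : R) (Y : 'M[C]_m) := expt X t *m Y *m expt (- X) t.

Lemma comm_mx_Adx t Y : 0 <= t -> P *m Y = Y *m P -> P *m Adx t Y = Adx t Y *m P.
Proof.
move=> t0 PY; apply: comm_mx_mul; last exact: (expt_comm t0 comm_mx_opp).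
by apply: comm_mx_mul => //; exact: expt_comm.
Qed.

Lemma opb_Adx t Y K : 0 <= t -> 0 <= K -> P *m Y = Y *m P ->
  opb P Y K -> opb P (Adx t Y) K.
Proof.
move=> t0 K0 PY hY; rewrite -[K]mul1r -[1 * K]mulr1.
apply: opbM; first by rewrite mul1r.
- exact: (expt_comm t0 comm_mx_opp).
- by apply: opbM => //; apply: opb_isometry; exact: expt_unitary.
- by apply: opb_isometry; apply: expt_unitary => //; exact: adj_opp.
Qed.

Definition taylor_Adx (r : nat) (t : R) (Y : 'M[C]_m) : 'M[C]_m :=
  \sum_(q < r) ((t ^+ q)%:C%C * (q`!%:R)^-1) *: iter q (commx X) Y.

Lemma dM_Adx t Y : dM (fun s => Adx s Y) t (Adx t (commx X Y)).
Proof.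
apply: dM_eq (dMM (dMMr Y (dM_exptr X t)) (dM_exptl (- X) t)) _.
rewrite /Adx /commx; move: (expt X t) (expt (- X) t) => E E'.
by rewrite mulmxBr mulmxBl mulNmx mulmxN !mulmxA.
Qed.

Lemma dM_taylor r t Y :
  dM (fun s => taylor_Adx r.+1 s Y) t (taylor_Adx r t (commx X Y)).
Proof.
apply: dM_eq (dM_sum (fun q => dM_monomial _ _ _ t)) _.
rewrite big_ord_recl /= mul0r rmorph0 mul0r scale0r add0r.
apply: eq_bigr => q _; rewrite /bump /= add1n -iterSr add0n; congr (_ *: _).
rewrite factS natrM invfM rmorphM rmorph_nat -!mulrA mulrCA; congr (_ * _).
by rewrite mulrA divff ?mul1r // pnatr_eq0.
Qed.

(** Differentiating in t replaces Y by [X, Y] and r + 1 by r, so the mean value inequality performs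
    the induction, with Y general. Nothing is integrated, hence t^r without 1 / r!. *)
Lemma opb_taylor_Adx r : forall Y K t, 0 <= t -> 0 <= K -> P *m Y = Y *m P ->
  opb P (iter r (commx X) Y) K -> opb P (Adx t Y - taylor_Adx r t Y) (K * t ^+ r).
Proof.
elim: r => [|r IH] Y K t t0 K0 PY hY.
  by rewrite /taylor_Adx big_ord0 subr0 mulr1; exact: opb_Adx.
apply: (@mvt_opb _ _ P (fun s => Adx s Y - taylor_Adx r.+1 s Y)
  (fun s => Adx s (commx X Y) - taylor_Adx r s (commx X Y))) => //.
- rewrite /Adx !expt_0 mulmx1 mul1mx /taylor_Adx big_ord_recl big1 => [|q _].
    by rewrite /= fact0 invr1 mulr1 scale1r addr0 subrr.
  by rewrite /= /bump /= expr0n /= rmorph0 mul0r scale0r.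
- by move=> s _; apply: dMB; [exact: dM_Adx|exact: dM_taylor].
- move=> s /andP[s0 _]; apply: IH => //; first exact: comm_mx_commx.
  by rewrite -iterSr.
Qed.

End OneStep.

(* A list [(c_1, b_1), ..., (c_L, b_L)] encodes the product of the
   exponentials [exp (t c_j Z_{b_j})]; [gen l t] is the left logarithmic
   derivative of this product and [genq l q] the q-th Taylor coefficient of
   [gen l] at 0, a combination of q-fold nested commutators. *)
Fixpoint prodl (l : seq (R * bool)) (t : R) : 'M[C]_m :=
  if l is (c, b) :: l' then expt (c%:C%C *: Z b) t *m prodl l' t else 1%:M.

Fixpoint gen (l : seq (R * bool)) (t : R) : 'M[C]_m :=
  if l is (c, b) :: l' then c%:C%C *: Z b + Adx (c%:C%C *: Z b) t (gen l' t) else 0.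

Fixpoint genq (l : seq (R * bool)) (q : nat) : 'M[C]_m :=
  if l is (c, b) :: l' then
    (if q == 0%N then c%:C%C *: Z b else 0) +
    \sum_(r < q.+1) (r`!%:R)^-1 *: iter r (commx (c%:C%C *: Z b)) (genq l' (q - r))
  else 0.

Lemma comm_mx_step c b : P *m (c%:C%C *: Z b) = (c%:C%C *: Z b) *m P.
Proof. exact: comm_mx_scale. Qed.

Lemma anti_step c b : adj (c%:C%C *: Z b) = - (c%:C%C *: Z b).
Proof.
rewrite adjZ antiZ scalerN; congr (- (_ *: _)).
exact: conjc_real.
Qed.

Lemma comm_mx_prodl l t : 0 <= t -> P *m prodl l t = prodl l t *m P.
Proof.
move=> t0; elim: l => [|[c b] l IH] /=; first by rewrite mulmx1 mul1mx.
by apply: comm_mx_mul => //; exact: (expt_comm t0 (comm_mx_step c b)).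
Qed.

Lemma prodl_unitary l t : 0 <= t -> adj (prodl l t) *m prodl l t = 1%:M.
Proof.
move=> t0; elim: l => [|[c b] l IH] /=; first by rewrite adj_id mulmx1.
rewrite adjM; move: (prodl l t) IH (expt _ t) (expt_unitary t0 (anti_step c b)).
by move=> S IH E EE; rewrite mulmxA -(mulmxA (adj S)) EE mulmx1.
Qed.

Lemma prodl_0 l : prodl l 0 = 1%:M.
Proof. by elim: l => [|[c b] l IH] //=; rewrite IH expt_0 mulmx1. Qed.

Lemma comm_mx_gen l t : 0 <= t -> P *m gen l t = gen l t *m P.
Proof.
move=> t0; elim: l => [|[c b] l IH] /=; first by rewrite mulmx0 mul0mx.
apply: comm_mx_add; first exact: comm_mx_step.
by apply: comm_mx_Adx => //; exact: comm_mx_step.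
Qed.

Lemma comm_mx_genq l q : P *m genq l q = genq l q *m P.
Proof.
elim: l q => [|[c b] l IH] q /=; first by rewrite mulmx0 mul0mx.
apply: comm_mx_add.
  by case: ifP => _; [exact: comm_mx_step|rewrite mulmx0 mul0mx].
apply: comm_mx_bigsum => r; apply: comm_mx_scale.
by apply: comm_mx_iter => //; exact: comm_mx_step.
Qed.

(** With X the first exponent and S' = D S for the remaining product, (e^{tX} S)' = X e^{tX} S +
    e^{tX} D S. Inserting e^{-tX} e^{tX} between D and S conjugates D, which is the recursion of
    [gen]. *)
Lemma dM_prodl l t : 0 <= t -> dM (prodl l) t (gen l t *m prodl l t).
Proof.
move=> t0; elim: l => [|[c b] l IH] /=; first by rewrite mul0mx; exact: dM_cst.
apply: dM_eq (dMM (dM_exptl _ t) IH) _.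
rewrite mulmxDl /Adx; set X := c%:C%C *: Z b.
move: (expt X t) (expt (- X) t) (expt_inv X t0) => E E' E'E.
move: (gen l t) (prodl l t) X => D S X.
by rewrite !mulmxA -(mulmxA _ E' E) E'E mulmx1.
Qed.

Section Bounded.
Variables (p : nat) (K : R).
Hypothesis K0 : 0 <= K.
Hypothesis HK : forall w b, size w = p -> opb P (adw Z w (Z b)) K.

(** M behaves like a combination of q-fold commutators with coefficients of total size c: completing
    it by any p - q further letters costs at most c K, where K bounds the p-fold commutators. *)
Definition nested (q : nat) (c : R) (M : 'M[C]_m) : Prop :=
  forall w, (size w + q = p)%N -> opb P (adw Z w M) (c * K).

Lemma nestedD q c d M N : nested q c M -> nested q d N -> nested q (c + d) (M + N).
Proof.
by move=> hM hN w sw; rewrite adwD mulrDl; apply: opbD; [exact: hM|exact: hN].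
Qed.

Lemma nestedZ q c a M : nested q c M -> nested q (cnorm a * c) (a *: M).
Proof. by move=> hM w sw; rewrite adwZ -mulrA; apply: opbZ; exact: hM. Qed.

Lemma nested0 q : nested q 0 0.
Proof. by move=> w _; rewrite adw0 mul0r; exact: opb0. Qed.

Lemma nested_sum n q (c : 'I_n -> R) M :
  (forall i, nested q (c i) (M i)) -> nested q (\sum_i c i) (\sum_i M i).
Proof.
move=> h; elim/big_ind2: _ => [|x1 x2 y1 y2|i _]; [exact: nested0|exact: nestedD|exact: h].
Qed.

Lemma nested_adw q c M u : nested q c M -> nested (q + size u) c (adw Z u M).
Proof.
move=> hM; elim: u => [|b u IH] /=; first by rewrite addn0.
move=> w sw; rewrite -adw_rcons; apply: (IH (rcons w b)).
by rewrite size_rcons -sw addSnnS -addnS.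
Qed.

Lemma nested_step c b : nested 0 (cnorm (c%:C%C : C)) (c%:C%C *: Z b).
Proof.
have h : nested 0 1 (Z b).
  by move=> w sw; rewrite mul1r; apply: HK; rewrite -sw addn0.
by have := nestedZ c%:C%C h; rewrite mulr1.
Qed.

End Bounded.

End Fixed.

(** [cstq] and [cstrem] copy with moduli the recursions of the coefficients and of the remainder. No
    matrix occurs, so they depend on the formula and the order alone. *)
Fixpoint cstq (l : seq (R * bool)) (q : nat) : R :=
  if l is (c, b) :: l' then
    (if q == 0%N then cnorm (c%:C%C : C) else 0) +
    \sum_(r < q.+1) cnorm ((r`!%:R)^-1 * (c%:C%C ^+ r) : C) * cstq l' (q - r)
  else 0.

Fixpoint cstrem (p : nat) (l : seq (R * bool)) : R :=
  if l is (c, b) :: l' then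
    cstrem p l' + \sum_(q < p) cnorm (c%:C%C ^+ (p - q) : C) * cstq l' q
  else 0.

Lemma cstq_ge0 l q : 0 <= cstq l q.
Proof.
elim: l q => [|[c b] l IH] q //=; apply: addr_ge0.
  by case: ifP => // _; exact: cnorm_ge0.
by apply: sumr_ge0 => r _; rewrite mulr_ge0 ?cnorm_ge0.
Qed.

Lemma cstrem_ge0 p l : 0 <= cstrem p l.
Proof.
elim: l => [|[c b] l IH] //=; apply: addr_ge0 => //.
by apply: sumr_ge0 => r _; rewrite mulr_ge0 ?cnorm_ge0 ?cstq_ge0.
Qed.

Section Expansion.
Variables (m : nat) (P : 'M[C]_m) (Z : bool -> 'M[C]_m).
Hypothesis PZ : forall b, P *m Z b = Z b *m P.
Hypothesis antiZ : forall b, adj (Z b) = - Z b.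
Variables (p : nat) (K : R).
Hypothesis p0 : (0 < p)%N.
Hypothesis K0 : 0 <= K.
Hypothesis HK : forall w b, size w = p -> opb P (adw Z w (Z b)) K.

Lemma nested_genq l q : nested P Z p K q (cstq l q) (genq Z l q).
Proof.
elim: l q => [|[c b] l IH] q /=; first exact: nested0.
apply: nestedD.
  by case: eqP => [->|_]; [exact: nested_step|exact: nested0].
apply: nested_sum => // r.
rewrite iter_commxZ scalerA; apply: nestedZ.
have := nested_adw (u := nseq r b) (IH (q - r)%N).
by rewrite size_nseq subnK // -ltnS.
Qed.

(** The conjugated coefficient of index q is cut at order p - q to keep the total degree below p;
    regrouping by total degree gives the recursion of [genq]. *)
Lemma sum_genq c b l (t : R) :
  \sum_(q < p) (t ^+ q)%:C%C *: genq Z ((c, b) :: l) q =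
  c%:C%C *: Z b + \sum_(q < p) (t ^+ q)%:C%C *:
     taylor_Adx (c%:C%C *: Z b) (p - q) t (genq Z l q).
Proof.
set X := c%:C%C *: Z b.
under eq_bigr => q _ do rewrite /= scalerDr.
rewrite big_split /= -/X; congr (_ + _).
  case: p p0 => // p' _; rewrite big_ord_recl big1 => [|q _].
    by rewrite /= expr0 scale1r addr0.
  by rewrite scaler0.
pose f q r : 'M[C]_m := ((t ^+ q)%:C%C * ((t ^+ r)%:C%C * (r`!%:R)^-1)) *:
   iter r (commx X) (genq Z l q).
transitivity (\sum_(q < p) \sum_(r < q.+1) f (q - r)%N r); last first.
  rewrite sum_triangle; apply: eq_bigr => q _; rewrite scaler_sumr.
  by apply: eq_bigr => r _; rewrite /f scalerA.
apply: eq_bigr => q _; rewrite scaler_sumr; apply: eq_bigr => r _.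
rewrite /f scalerA mulrA -rmorphM -exprD subnK //.
by rewrite -ltnS.
Qed.

Lemma gen_expansion l t : 0 <= t ->
  opb P (gen Z l t - \sum_(q < p) (t ^+ q)%:C%C *: genq Z l q)
        (cstrem p l * K * t ^+ p).
Proof.
move=> t0; elim: l => [|[c b] l IH].
  rewrite /= big1 => [|q _]; last by rewrite scaler0.
  by rewrite subrr !mul0r; exact: opb0.
rewrite sum_genq /=; set X := c%:C%C *: Z b.
have PX : P *m X = X *m P by exact: comm_mx_step.
have aX : adj X = - X by exact: anti_step.
pose S := \sum_(q < p) (t ^+ q)%:C%C *: genq Z l q.
have PS : P *m S = S *m P.
  by apply: comm_mx_bigsum => q; apply: comm_mx_scale; exact: comm_mx_genq.
(* The remainder for l is conjugated by unitaries and keeps its bound. What is added is the Taylor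
   remainder of each coefficient at order p - q: p - q commutators applied to a q-fold one, thus
   p-fold. *)
rewrite [X in opb _ X _](_ : _ = Adx X t (gen Z l t - S) +
   \sum_(q < p) (t ^+ q)%:C%C *:
     (Adx X t (genq Z l q) - taylor_Adx X (p - q) t (genq Z l q))); last first.
  rewrite opprD addrACA subrr add0r.
  under [in RHS]eq_bigr => q _ do rewrite scalerBr.
  rewrite sumrB addrA; congr (_ - _).
  rewrite /Adx mulmxBr mulmxBl /S mulmx_sumr mulmx_suml.
  rewrite (eq_bigr (fun q : 'I_p => (t ^+ q)%:C%C *: (expt X t *m genq Z l q *m expt (- X) t))).
    by rewrite subrK.
  by move=> q _; rewrite -scalemxAr -scalemxAl.
rewrite !mulrDl; apply: opbD.
  apply: opb_Adx => //.
    by rewrite !mulr_ge0 ?cstrem_ge0 ?exprn_ge0.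
  by apply: comm_mx_sub => //; exact: comm_mx_gen.
rewrite !mulr_suml; apply: opb_sum => q.
have qp : (q <= p)%N by rewrite ltnW.
rewrite [X in opb _ _ X](_ : _ = cnorm ((t ^+ q)%:C%C : C) *
  (cnorm (c%:C%C ^+ (p - q) : C) * (cstq l q * K) * t ^+ (p - q))); last first.
  have -> : t ^+ p = t ^+ q * t ^+ (p - q) by rewrite -exprD subnKC.
  by rewrite cnorm_real ger0_norm ?exprn_ge0 //; ring.
apply: opbZ; apply: opb_taylor_Adx => //.
- by rewrite !mulr_ge0 ?cnorm_ge0 ?cstq_ge0.
- exact: comm_mx_genq.
- rewrite iter_commxZ; apply: opbZ; apply: nested_genq.
  by rewrite size_nseq subnK.
Qed.

End Expansion.

(** There are finitely many words of length p. The constant depends on Z, which is harmless when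
    only the vanishing of coefficients is at stake. *)
Lemma adw_bounded m (P : 'M[C]_m) (Z : bool -> 'M[C]_m) p :
  exists2 K : R, 0 <= K & forall w b, size w = p -> opb P (adw Z w (Z b)) K.
Proof.
have h (T : finType) (F : T -> 'M[C]_m) :
    exists2 K : R, 0 <= K & forall x, opb P (F x) K.
  have [f f0 hf] : exists2 f : T -> R, (forall x, 0 <= f x) & forall x, opb P (F x) (f x).
    have /choice[f hf] : forall x, exists K : R, 0 <= K /\ opb P (F x) K.
      by move=> x; have [K ? ?] := opb_bounded P (F x); exists K.
    by exists f => x; have [] := hf x.
  exists (\sum_x f x); first exact: sumr_ge0.
  move=> x; apply: opb_le (hf x); rewrite (bigD1 x) //= lerDl.
  exact: sumr_ge0.
have [K K0 hK] := h _ (fun x : p.-tuple bool * bool => adw Z x.1 (Z x.2)).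
exists K => // w b sw; have sw' : size w == p by apply/eqP.
exact: (hK (Tuple sw', b)).
Qed.

Section Error.
Variables (m : nat) (Z : bool -> 'M[C]_m).
Hypothesis antiZ : forall b, adj (Z b) = - Z b.
Let H := Z true + Z false.

Lemma anti_H : adj H = - H.
Proof. by rewrite /H adjD !antiZ opprD. Qed.

(** The product formula in the interaction picture: its derivative involves [gen] only through
    [gen - H], placed between unitaries. *)
Definition wave l t : 'M[C]_m := expt (- H) t *m prodl Z l t.

Lemma dM_wave l t : 0 <= t ->
  dM (wave l) t (expt (- H) t *m (gen Z l t - H) *m prodl Z l t).
Proof.
move=> t0; apply: dM_eq (dMM (dM_exptr (- H) t) (dM_prodl _ l t0)) _.
move: (expt _ t) (gen _ _ t) (prodl _ _ t) => E D S; move: H => H'.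
by rewrite mulmxN mulNmx mulmxBr mulmxBl mulmxA addrC.
Qed.

Lemma wave_error l t : 0 <= t ->
  prodl Z l t - expt H t = expt H t *m (wave l t - 1%:M).
Proof.
move=> t0; have := expt_inv (- H) t0; rewrite opprK /wave.
move: (expt H t) (expt (- H) t) (prodl Z l t) => E E' S EE'.
by rewrite mulmxBr mulmx1 mulmxA EE' mul1mx.
Qed.

Lemma expt_H_opb P t : 0 <= t -> opb P (expt H t) 1 /\ opb P (expt (- H) t) 1.
Proof.
move=> t0; split; apply: opb_isometry; apply: expt_unitary => //.
  exact: anti_H.
by rewrite adjN anti_H.
Qed.

Lemma opb_wave_deriv (P : 'M[C]_m) l t M K : 0 <= t -> 0 <= K ->
  (forall b, P *m Z b = Z b *m P) -> P *m M = M *m P -> opb P M K ->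
  opb P (expt (- H) t *m M *m prodl Z l t) K.
Proof.
move=> t0 K0 PZ PM hM; rewrite -[K]mul1r -[1 * K]mulr1.
apply: opbM; first by rewrite mul1r.
- exact: comm_mx_prodl.
- by apply: opbM => //; exact: (proj2 (expt_H_opb P t0)).
- by apply: opb_isometry; exact: prodl_unitary.
Qed.

Lemma trotter_error (P : 'M[C]_m) l p K :
  (forall b, P *m Z b = Z b *m P) -> (0 < p)%N -> 0 <= K ->
  (forall w b, size w = p -> opb P (adw Z w (Z b)) K) ->
  (forall q, (q < p)%N -> genq Z l q = if q == 0%N then H else 0) ->
  forall t, 0 <= t ->
  opb P (prodl Z l t - expt H t) (cstrem p l * K * t ^+ p.+1).
Proof.
move=> PZ p0 K0 HK Hq t t0.
have PH : P *m H = H *m P by apply: comm_mx_add.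
have c0 : 0 <= cstrem p l * K by rewrite mulr_ge0 ?cstrem_ge0.
rewrite wave_error // -[X in opb _ _ X]mul1r; apply: opbM => //; last first.
- apply: (@mvt_opb _ _ P (fun s => wave l s - 1%:M)
    (fun s => expt (- H) s *m (gen Z l s - H) *m prodl Z l s)) => //.
  + by rewrite /wave prodl_0 expt_0 mulmx1 subrr.
  + move=> s /andP[s0 _]; apply: dM_eq (dMB (dM_wave l s0) (dM_cst _ _)) _.
    by rewrite subr0.
  + move=> s /andP[s0 _]; apply: opb_wave_deriv => //.
    * by rewrite mulr_ge0 ?exprn_ge0.
    * by apply: comm_mx_sub => //; exact: comm_mx_gen.
    (* By the hypothesis on [genq] the subtracted polynomial collapses to its constant term H, so
       that [gen - H] is entirely remainder. *)
    have := gen_expansion PZ antiZ p0 K0 HK l s0.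
    rewrite [X in opb _ (_ - X) _](_ : _ = H) //.
    case: p p0 Hq {HK c0} => // p' _ Hq; rewrite big_ord_recl big1 => [|q _].
      by rewrite Hq // expr0 scale1r addr0.
    by rewrite Hq ?ltn_ord //= scaler0.
- exact: (proj1 (expt_H_opb P t0)).
- apply: comm_mx_sub; last by rewrite mulmx1 mul1mx.
  apply: comm_mx_mul; last exact: comm_mx_prodl.
  by apply: expt_comm => //; rewrite mulmxN mulNmx PH.
Qed.

Lemma opb1_gen_bounded l : exists2 K : R, 0 <= K &
  forall t, 0 <= t -> opb 1%:M (gen Z l t) K.
Proof.
have comm1 (X : 'M[C]_m) : 1%:M *m X = X *m 1%:M by rewrite mulmx1 mul1mx.
elim: l => [|[c b] l [K K0 IH]] /=; first by exists 0 => // t t0; exact: opb0.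
have [L L0 hL] := opb_bounded 1%:M (c%:C%C *: Z b).
exists (L + K) => [|t t0]; first exact: addr_ge0.
by apply: opbD => //; apply: opb_Adx => //; [exact: anti_step|exact: IH].
Qed.

Lemma opb1_sub_id (F F' : R -> 'M[C]_m) K : 0 <= K -> F 0 = 1%:M ->
  (forall s, 0 <= s -> dM F s (F' s)) ->
  (forall s, 0 <= s -> opb 1%:M (F' s) K) ->
  forall t, 0 <= t -> opb 1%:M (F t - 1%:M) (K * t).
Proof.
move=> K0 F0 dF hF t t0; rewrite -[t in K * t]expr1.
apply: (@mvt_opb _ _ _ (fun s => F s - 1%:M) F') => //.
- by rewrite F0 subrr.
- move=> s /andP[s0 _]; apply: dM_eq (dMB (dF s s0) (dM_cst _ _)) _.
  by rewrite subr0.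
- by move=> s /andP[s0 _]; rewrite mulr1; exact: hF.
Qed.

Lemma wave_algebra (E D S G : 'M[C]_m) (a : C) :
  E *m D *m S - a *: G = E *m (D - a *: G) *m S +
    a *: (E *m (G *m (S - 1%:M)) + (E - 1%:M) *m G).
Proof.
rewrite !(mulmxBr, mulmxBl) !mulmx1 mul1mx -scalemxAr -scalemxAl !mulmxA.
by rewrite addrA subrK scalerBr addrA subrK.
Qed.

(* If [G] is the first coefficient of [gen l - H] which could be nonzero, of
   index [q], then [wave l t - 1 = t^(q+1) / (q+1) G + O(t^(q+2))]. *)
Lemma genq_vanish l p K delta : 0 < delta ->
  (forall t, 0 <= t <= delta ->
     opb 1%:M (prodl Z l t - expt H t) (K * t ^+ p.+1)) ->
  forall q, (q < p)%N -> genq Z l q = if q == 0%N then H else 0.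
Proof.
move=> d0 hO; elim/ltn_ind => q IH qp.
have comm1 (X : 'M[C]_m) : 1%:M *m X = X *m 1%:M by rewrite mulmx1 mul1mx.
pose G := genq Z l q - (if q == 0%N then H else 0).
suff : G = 0 by move/eqP; rewrite subr_eq0 => /eqP.
(* The expansion is taken to order q + 1, so that the coefficient under examination is the last one
   kept. *)
have [K1 K10 hK1] := adw_bounded 1%:M Z q.+1.
have [K2 K20 hK2] := opb1_gen_bounded l.
have [K3 K30 hK3] := opb_bounded 1%:M G.
have [K4 K40 hK4] := opb_bounded 1%:M H.
have hrem t : 0 <= t ->
    opb 1%:M (gen Z l t - H - (t ^+ q)%:C%C *: G) (cstrem q.+1 l * K1 * t ^+ q.+1).
  move=> t0; have := gen_expansion (fun b => comm1 _) antiZ (ltn0Sn q) K10 hK1 l t0.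
  rewrite big_ord_recr /= [X in opb _ X _ -> _](_ : _ = gen Z l t - H - (t ^+ q)%:C%C *: G) //.
  rewrite /G scalerBr; case: q IH qp {G hK3 hK1} => [|q] IH qp.
    by rewrite big_ord0 add0r expr0 !scale1r opprB addrA subrK.
  rewrite scaler0 subr0 big_ord_recl big1 => [|r _].
    have -> : genq Z l (ord0 : 'I_q.+1) = H by rewrite IH //= (ltn_trans _ qp).
    have -> : t ^+ (ord0 : 'I_q.+1) = 1 by rewrite expr0.
    by rewrite scale1r addr0 opprD addrA.
  have rq : (r.+1 < q.+1)%N by rewrite ltnS ltn_ord.
  by rewrite IH ?scaler0 //= /bump /= ?add1n // (ltn_trans rq qp).
have prod1 t : 0 <= t -> opb 1%:M (prodl Z l t - 1%:M) (K2 * t).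
  apply: (opb1_sub_id (F' := fun s => gen Z l s *m prodl Z l s) K20 (prodl_0 Z l)).
    by move=> s s0; exact: dM_prodl.
  move=> s s0; rewrite -[K2]mulr1.
  apply: opbM; [exact: K20|exact: comm1|exact: hK2|].
  by apply: opb_isometry; exact: prodl_unitary.
have exp1 t : 0 <= t -> opb 1%:M (expt (- H) t - 1%:M) (K4 * t).
  apply: (opb1_sub_id (F' := fun s => expt (- H) s *m (- H)) K40 (expt_0 _)).
    by move=> s s0; exact: dM_exptr.
  move=> s s0; rewrite -[K4]mul1r.
  by apply: opbM; [exact: ler01|exact: comm1|exact: (proj2 (expt_H_opb _ s0))|exact: opbN].
pose kap := cstrem q.+1 l * K1 + (K3 * K2 + K4 * K3).
have kap0 : 0 <= kap by rewrite addr_ge0 ?mulr_ge0 ?cstrem_ge0 // addr_ge0 ?mulr_ge0.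
have deriv t : 0 <= t -> opb 1%:M
    (expt (- H) t *m (gen Z l t - H) *m prodl Z l t - (t ^+ q)%:C%C *: G) (kap * t ^+ q.+1).
  move=> t0.
  pose Rm := gen Z l t - H - (t ^+ q)%:C%C *: G.
  rewrite [X in opb _ X _](_ : _ = expt (- H) t *m Rm *m prodl Z l t +
     (t ^+ q)%:C%C *: (expt (- H) t *m (G *m (prodl Z l t - 1%:M)) +
        (expt (- H) t - 1%:M) *m G)); last exact: wave_algebra.
  rewrite mulrDl; apply: opbD.
    by apply: opb_wave_deriv => //; [rewrite !mulr_ge0 ?cstrem_ge0 ?exprn_ge0|exact: hrem].
  rewrite [X in opb _ _ X](_ : _ = cnorm ((t ^+ q)%:C%C : C) *
     (1 * (K3 * (K2 * t)) + (K4 * t) * K3)); last first.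
    rewrite cnorm_real ger0_norm ?exprn_ge0 // exprS; ring.
  apply: opbZ; apply: opbD.
    apply: opbM; [exact: ler01|exact: comm1|exact: (proj2 (expt_H_opb _ t0))|].
    by apply: opbM; [exact: K30|exact: comm1|exact: hK3|exact: prod1].
  by apply: opbM; [rewrite mulr_ge0|exact: comm1|exact: exp1|exact: hK3].
have main t : 0 <= t -> opb 1%:M
    (wave l t - 1%:M - ((t ^+ q.+1)%:C%C * (q.+1%:R)^-1) *: G) (kap * t ^+ q.+2).
  move=> t0.
  apply: (@mvt_opb _ _ _ (fun s => wave l s - 1%:M - ((s ^+ q.+1)%:C%C * (q.+1%:R)^-1) *: G)
    (fun s => expt (- H) s *m (gen Z l s - H) *m prodl Z l s - (s ^+ q)%:C%C *: G)) => //.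
  - by rewrite /wave prodl_0 expt_0 mulmx1 subrr expr0n mul0r scale0r subr0.
  - move=> s /andP[s0 _].
    apply: dM_eq (dMB (dMB (dM_wave l s0) (dM_cst _ _)) (dM_monomial _ _ _ _)) _.
    rewrite subr0 /=; congr (_ - _ *: _).
    by rewrite rmorphM rmorph_nat mulrAC divff ?mul1r // pnatr_eq0.
  - by move=> s /andP[s0 _]; exact: deriv.
apply: opb_eq0 => v _; rewrite mul0r.
(* Comparison of [main] with the assumed order: since q + 2 <= p + 1 and t <= 1, dividing by t^(q+1)
   / (q+1) bounds |G v| by a multiple of t. *)
have small t : 0 < t -> t <= delta -> t <= 1 ->
    vnorm (G *m v) <= q.+1%:R * (kap + `|K|) * vnorm v * t.
  move=> t0 td t1; have t0' := ltW t0.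
  have h1 : opb 1%:M (wave l t - 1%:M) (`|K| * t ^+ p.+1).
    have -> : wave l t - 1%:M = expt (- H) t *m (prodl Z l t - expt H t).
      rewrite /wave; move: (expt H t) (expt (- H) t) (prodl Z l t) (expt_inv H t0').
      by move=> E E' S E'E; rewrite mulmxBr E'E.
    rewrite -[X in opb _ _ X]mul1r.
    apply: opbM; [exact: ler01|exact: comm1|exact: (proj2 (expt_H_opb _ t0'))|].
    apply: opb_le (hO t _); last by rewrite t0' td.
    by apply: ler_wpM2r (ler_norm _); exact: exprn_ge0.
  have := opbB h1 (main t t0') (mul1mx v).
  rewrite opprB addrC subrK -scalemxAl vnormZ => h2.
  have E : cnorm ((t ^+ q.+1)%:C%C * (q.+1%:R)^-1 : C) = t ^+ q.+1 / q.+1%:R.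
    have -> : (t ^+ q.+1)%:C%C * (q.+1%:R)^-1 = (t ^+ q.+1 / q.+1%:R)%:C%C :> C.
      by rewrite rmorphM fmorphV rmorph_nat.
    by rewrite cnorm_real ger0_norm // divr_ge0 ?ler0n ?exprn_ge0.
  have tq : 0 < t ^+ q.+1 by rewrite exprn_gt0.
  have qn : 0 < q.+1%:R :> R by rewrite ltr0n.
  have ptq : t ^+ p.+1 <= t ^+ q.+1 * t.
    by rewrite -exprSr; apply: ler_wiXn2l => //; rewrite ltnS.
  rewrite -(ler_pM2l tq) -(ler_pM2r (x := q.+1%:R^-1)) ?invr_gt0 //.
  apply: le_trans (_ : (`|K| * t ^+ p.+1 + kap * t ^+ q.+2) * vnorm v <= _).
    by apply: le_trans h2; rewrite E le_eqVlt; apply/orP; left; apply/eqP; ring.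
  rewrite [leRHS](_ : _ = (`|K| * (t ^+ q.+1 * t) + kap * t ^+ q.+2) * vnorm v).
    apply: ler_wpM2r; first exact: vnorm_ge0.
    by rewrite lerD2r; apply: ler_wpM2l.
  by rewrite (exprSr t q.+1); field; rewrite nat1r pnatr_eq0.
rewrite leNgt; apply/negP => Gv.
pose A := q.+1%:R * (kap + `|K|) * vnorm v.
have A0 : 0 <= A.
  apply: mulr_ge0; last exact: vnorm_ge0.
  by apply: mulr_ge0; [exact: ler0n|apply: addr_ge0].
(* The last entry forces 2 (A + 1) t <= |G v|, incompatible with |G v| <= A t for t > 0; the other
   two make t admissible in [small]. *)
pose t := Num.min (Num.min delta 1) (vnorm (G *m v) / (2 * (A + 1))).
have A1 : 0 < 2 * (A + 1) by rewrite mulr_gt0 // ltr_wpDl.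
have t0 : 0 < t by rewrite !lt_min d0 ltr01 divr_gt0.
have := small t t0; rewrite !ge_min !lexx /= orbT => /(_ isT isT).
rewrite -/A => h.
have : t * (2 * (A + 1)) <= vnorm (G *m v).
  by rewrite -ler_pdivlMr // ge_min lexx orbT.
nra.
Qed.

End Error.
End TrotterError.

(** * Nested commutators of sums of local terms *)

Section Locality.
Variable R : realType.
Local Notation C := (R[i]).
Variables (m : nat) (X : finType).
Variable h : bool -> X -> X -> 'M[C]_m.
Variable w : bool -> X -> X -> R.
Variable g : bool -> R.
(** [nb] is a norm bound and [kill] ties a term to its support. For particles they become the
    operator norm and nonemptiness of the support; for orbitals, the column sum and vanishing on
    configurations empty on the support. Only their validity for local terms and their passage
    through a commutator are used. *)
Variable nb : 'M[C]_m -> R -> Prop.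
Variable kill : 'M[C]_m -> {set X} -> Prop.

Hypothesis w0 : forall b x y, 0 <= w b x y.
Hypothesis nb_h : forall b x y, nb (h b x y) (w b x y).
Hypothesis nb_comm : forall M N c d, 0 <= c -> 0 <= d -> nb M c -> nb N d ->
  nb (commx M N) (2 * c * d).
Hypothesis kill_h : forall b x y, kill (h b x y) [set x; y].
Hypothesis kill_comm : forall b x y M S, kill M S ->
  kill (commx (h b x y) M) (S :|: [set x; y]).
Hypothesis h_comm : forall b x y b' x' y',
  [disjoint [set x; y] & [set x'; y']] -> commx (h b x y) (h b' x' y') = 0.
Hypothesis w_row : forall b x, \sum_y w b x y <= g b.
Hypothesis w_col : forall b y, \sum_x w b x y <= g b.

Lemma g_ge0 b (x : X) : 0 <= g b.
Proof. by apply: le_trans (w_row b x); apply: sumr_ge0. Qed.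

Definition extsum b : 'M[C]_m := \sum_x \sum_y h b x y.

Definition commutes_off (M : 'M[C]_m) (S : {set X}) :=
  forall b x y, [disjoint [set x; y] & S] -> commx (h b x y) M = 0.

Local Notation term := ('M[C]_m * ({set X} * R))%type.

Record local_term (k : nat) (s : term) : Prop := LocalTerm {
  lt_card : (#|s.2.1| <= k)%N;
  lt_ge0 : 0 <= s.2.2;
  lt_nb : nb s.1 s.2.2;
  lt_kill : kill s.1 s.2.1;
  lt_comm : commutes_off s.1 s.2.1 }.

(** Weight is measured at each site rather than in total, so that in the end it can be summed over
    the occupied orbitals only. *)
Definition local_sum (k : nat) (D : R) (M : 'M[C]_m) : Prop :=
  exists l : seq term,
    [/\ M = \sum_(s <- l) s.1, forall s, s \in l -> local_term k s &
        forall x, \sum_(s <- l | x \in s.2.1) s.2.2 <= D].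

(** A term meeting O contains a point of O, so it is counted at least once among the weights at the
    points of O. It serves for pairs meeting a support, for terms meeting a pair, and finally for
    the eta particles or occupied orbitals. *)
Lemma sum_touching (I : eqType) (r : seq I) (S : I -> {set X}) (c : I -> R)
    (O : {set X}) (D : R) :
  {in r, forall i, 0 <= c i} -> (forall x, \sum_(i <- r | x \in S i) c i <= D) ->
  \sum_(i <- r | ~~ [disjoint S i & O]) c i <= #|O|%:R * D.
Proof.
move=> c0 hD.
apply: (@le_trans _ _ (\sum_(x in O) \sum_(i <- r | x \in S i) c i)).
  under [leRHS]eq_bigr => x _ do rewrite big_mkcond.
  rewrite exchange_big /= big_mkcond /= big_seq [leRHS]big_seq.
  apply: ler_sum => i ir; have ci := c0 i ir.
  have ge0 x : 0 <= (if x \in S i then c i else 0) by case: ifP.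
  case: ifP => [|_]; last exact: sumr_ge0.
  rewrite -setI_eq0 => /set0Pn[x]; rewrite inE => /andP[xS xO].
  by rewrite (bigD1 x) //= xS lerDl sumr_ge0.
rewrite -sum1_card natr_sum mulr_suml; apply: ler_sum => x _.
by rewrite mul1r.
Qed.

Lemma sum_pairs_at b x :
  \sum_(p : X * X | x \in [set p.1; p.2]) w b p.1 p.2 <= 2 * g b.
Proof.
apply: (@le_trans _ _ (\sum_(p : X * X | p.1 == x) w b p.1 p.2 +
                       \sum_(p : X * X | p.2 == x) w b p.1 p.2)).
  rewrite [leLHS]big_mkcond [X in X + _]big_mkcond [X in _ + X]big_mkcond.
  rewrite -big_split /=; apply: ler_sum => p _; rewrite !inE !(eq_sym x).
  by case: eqP => _; case: eqP => _ /=; rewrite ?addr0 ?add0r ?lerDl ?lexx.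
rewrite mulr_natl mulr2n; apply: lerD.
  rewrite (eq_bigl (fun p => pred1 x p.1 && predT p.2)) => [|p]; last by rewrite andbT.
  rewrite -(pair_big (pred1 x) predT (fun x y => w b x y)) /= big_pred1_eq.
  exact: w_row.
rewrite -(pair_big predT (pred1 x) (fun x y => w b x y)) /=.
under eq_bigr => y _ do rewrite big_pred1_eq.
exact: w_col.
Qed.

Lemma sum_touching_pairs b (S : {set X}) :
  \sum_(p : X * X | ~~ [disjoint [set p.1; p.2] & S]) w b p.1 p.2
    <= #|S|%:R * (2 * g b).
Proof.
apply: (@sum_touching _ _ (fun p : X * X => [set p.1; p.2])
  (fun p : X * X => w b p.1 p.2)) => // x.
exact: sum_pairs_at.
Qed.

Lemma local_sum_base b : local_sum 2 (2 * g b) (extsum b).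
Proof.
exists [seq (h b p.1 p.2, ([set p.1; p.2], w b p.1 p.2)) | p <- enum {: X * X}]; split.
- by rewrite big_map big_enum /= /extsum pair_big.
- move=> s /mapP[[x y] _ ->] /=; split => //=.
    by rewrite cards2; case: (_ != _).
  move=> b' x' y'; exact: h_comm.
- by move=> x; rewrite big_map /= big_enum_cond /=; exact: sum_pairs_at.
Qed.

Lemma commx_suml (I : Type) (r : seq I) (F : I -> 'M[C]_m) (P : pred I) M :
  commx (\sum_(i <- r | P i) F i) M = \sum_(i <- r | P i) commx (F i) M.
Proof. by rewrite /commx mulmx_suml mulmx_sumr sumrB. Qed.

Lemma commx_sumr (I : Type) (r : seq I) (F : I -> 'M[C]_m) (P : pred I) M :
  commx M (\sum_(i <- r | P i) F i) = \sum_(i <- r | P i) commx M (F i).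
Proof. by rewrite /commx mulmx_suml mulmx_sumr sumrB. Qed.

Lemma commx_jacobi0 (A B M : 'M[C]_m) :
  commx A B = 0 -> commx A M = 0 -> commx A (commx B M) = 0.
Proof.
move=> /eqP; rewrite subr_eq0 => /eqP AB /eqP; rewrite subr_eq0 => /eqP AM.
apply/eqP; rewrite subr_eq0; apply/eqP/comm_mx_commx => //.
Qed.

Lemma commx_local b (s : term) k : local_term k s ->
  commx (extsum b) s.1 =
  \sum_(p : X * X | ~~ [disjoint [set p.1; p.2] & s.2.1]) commx (h b p.1 p.2) s.1.
Proof.
move=> hs; rewrite /extsum pair_big commx_suml [RHS]big_mkcond /=.
apply: eq_bigr => p _; case: ifPn => //; rewrite negbK => /(lt_comm hs); exact.
Qed.

(** Only pairs p meeting the support S of a term survive. If a new term contains x, either x lies in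
    S, giving 2 * k * 2g * D from the pairs meeting S, or x lies in p, giving 2 * 2g * 2D from the
    terms meeting the two points of p. The leading 2 is the cost of a commutator. *)
Lemma local_sum_step b k D M : local_sum k D M ->
  local_sum k.+2 ((4 * k%:R + 8) * g b * D) (commx (extsum b) M).
Proof.
move=> [l [-> hl hD]].
pose tch (s : term) := [seq p <- enum {: X * X} | ~~ [disjoint [set p.1; p.2] & s.2.1]].
pose f (s : term) (p : X * X) : term :=
  (commx (h b p.1 p.2) s.1, (s.2.1 :|: [set p.1; p.2], 2 * w b p.1 p.2 * s.2.2)).
have nn s : s \in l -> 0 <= s.2.2 by move=> /hl /lt_ge0.
exists [seq f s p | s <- l, p <- tch s]; split.
- rewrite commx_sumr big_allpairs_dep /= big_seq [RHS]big_seq; apply: eq_bigr => s sl.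
  by rewrite (commx_local b (hl s sl)) big_filter big_enum_cond.
- move=> s' /allpairsPdep[s [[x y] [sl]]].
  rewrite mem_filter /= => /andP[xyS _] ->; have [h1 h2 h3 h4 h5] := hl s sl.
  split => /=.
  + apply: leq_trans (leq_card_setU _ _) _; rewrite -addn2; apply: leq_add => //.
    by rewrite cards2; case: (_ != _).
  + by rewrite !mulr_ge0.
  + exact: nb_comm.
  + exact: kill_comm.
  + move=> b' x' y'; rewrite disjoint_sym finset.disjoints_subset finset.subUset.
    rewrite -!finset.disjoints_subset => /andP[d1 d2]; apply: commx_jacobi0.
      by apply: h_comm; rewrite disjoint_sym.
    by apply: h5; rewrite disjoint_sym.
- move=> x; rewrite big_mkcond big_allpairs_dep /=.
  have eqf s : \sum_(p <- tch s) (if x \in s.2.1 :|: [set p.1; p.2]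
        then 2 * w b p.1 p.2 * s.2.2 else 0) =
      \sum_(p : X * X | ~~ [disjoint [set p.1; p.2] & s.2.1])
        (if x \in s.2.1 :|: [set p.1; p.2] then 2 * w b p.1 p.2 * s.2.2 else 0).
    by rewrite big_filter big_enum_cond.
  under eq_bigr => s _ do rewrite eqf.
  have c2 (p : X * X) : 0 <= 2 * w b p.1 p.2 by rewrite mulr_ge0.
  apply: (@le_trans _ _
    (\sum_(s <- l | x \in s.2.1) s.2.2 * (k%:R * (4 * g b)) +
     \sum_(p : X * X | x \in [set p.1; p.2]) 2 * w b p.1 p.2 * (2 * D))); last first.
    rewrite -mulr_suml -mulr_suml -mulr_sumr.
    have h1 := hD x; have h2 := sum_pairs_at b x; have g0 := g_ge0 b x.
    have D0 : 0 <= D.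
      apply: le_trans (hD x); rewrite big_seq_cond.
      by apply: sumr_ge0 => s /andP[/nn].
    rewrite (_ : (4 * k%:R + 8) * g b * D = D * (k%:R * (4 * g b)) + 2 * (2 * g b) * (2 * D)); last by ring.
    apply: lerD; apply: ler_wpM2r => //; first by rewrite !mulr_ge0 ?ler0n.
      by rewrite mulr_ge0.
    by rewrite ler_wpM2l.
  pose A (s : term) (p : X * X) : R :=
    if (x \in s.2.1) && ~~ [disjoint [set p.1; p.2] & s.2.1] then 2 * w b p.1 p.2 * s.2.2 else 0.
  pose B (s : term) (p : X * X) : R :=
    if (x \in [set p.1; p.2]) && ~~ [disjoint [set p.1; p.2] & s.2.1] then 2 * w b p.1 p.2 * s.2.2 else 0.
  apply: (@le_trans _ _ (\sum_(s <- l) \sum_(p : X * X) A s p +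
                         \sum_(s <- l) \sum_(p : X * X) B s p)).
    rewrite -big_split /= big_seq [leRHS]big_seq; apply: ler_sum => s sl.
    rewrite -big_split /= big_mkcond /=; apply: ler_sum => p _.
    have z0 : 0 <= 2 * w b p.1 p.2 * s.2.2 by rewrite mulr_ge0 ?nn.
    rewrite /A /B finset.in_setU; case: (~~ _); rewrite ?andbT ?andbF ?addr0 //.
    by case: (x \in s.2.1); case: (x \in [set p.1; p.2]); rewrite /= ?addr0 ?add0r ?lerDl.
  apply: lerD.
    rewrite [leRHS]big_mkcond big_seq [leRHS]big_seq; apply: ler_sum => s sl.
    rewrite /A; case: ifP => xs /=; last by rewrite big1.
    rewrite -big_mkcond -mulr_suml mulrC; apply: ler_wpM2l; first exact: nn.
    rewrite -mulr_sumr (_ : k%:R * (4 * g b) = 2 * (k%:R * (2 * g b))); last by ring.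
    apply: ler_wpM2l => //; apply: le_trans (sum_touching_pairs b s.2.1) _.
    apply: ler_wpM2r; first by rewrite mulr_ge0 // (g_ge0 b x).
    by rewrite ler_nat; exact: (lt_card (hl s sl)).
  rewrite exchange_big /= [leRHS]big_mkcond; apply: ler_sum => p _.
  rewrite /B; case: ifP => xs /=; last by rewrite big1.
  rewrite -big_mkcond -mulr_sumr; apply: ler_wpM2l => //.
  have := @sum_touching _ l (fun s => s.2.1) (fun s => s.2.2) [set p.1; p.2] D nn hD.
  under [X in X <= _ -> _]eq_bigl => s do rewrite disjoint_sym.
  move=> hs; apply: le_trans hs _; apply: ler_wpM2r.
    apply: le_trans (hD x); rewrite big_seq_cond.
    by apply: sumr_ge0 => s /andP[/nn].
  by rewrite ler_nat cards2; case: (_ != _).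
Qed.

(** After k' commutators a support has at most 2 k' + 2 sites, the k of [local_sum_step]. The
    initial 2 is that of [local_sum_base], where a site may be either entry of a pair. *)
Fixpoint cst_local (k : nat) : R :=
  if k is k'.+1 then (4 * (2 * k').+2%:R + 8) * cst_local k' else 2.

Lemma cst_local_ge0 k : 0 <= cst_local k.
Proof.
by elim: k => [|k IH] //=; rewrite mulr_ge0 // addr_ge0 ?mulr_ge0 ?ler0n.
Qed.

Lemma local_sum_adw u b :
  local_sum (2 * size u).+2 (cst_local (size u) * (\prod_(c <- u) g c) * g b)
    (adw extsum u (extsum b)).
Proof.
elim: u => [|c u IH] /=.
  by rewrite big_nil mulr1; exact: local_sum_base.
have := local_sum_step c IH; rewrite mulnS addnC addn2 big_cons.
set M := commx _ _; rewrite (_ : _ * _ * _ = cst_local (size u).+1 *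
   (g c * \prod_(c <- u) g c) * g b) //=.
by ring.
Qed.

End Locality.

(** * Occupation numbers and the anticommutation relations *)

Section Bits.
Local Open Scope nat_scope.
Implicit Types b j k n : nat.

Definition bit b j : bool := odd (b %/ 2 ^ j).

Lemma bitS b j : bit b j.+1 = bit (b %/ 2) j.
Proof. by rewrite /bit expnS divnMA. Qed.

Lemma bit_inj a b : bit a =1 bit b -> a = b.
Proof.
elim/ltn_ind: a b => a IH b h.
have h0 : odd a = odd b by have := h 0; rewrite /bit !divn1.
have h1 k : bit (a %/ 2) k = bit (b %/ 2) k by rewrite -!bitS.
suff : a %/ 2 = b %/ 2.
  rewrite !divn2 => E.
  by rewrite -[a]odd_double_half -[b]odd_double_half h0 E.
(* For a = 0 halving no longer decreases a; a second induction, on b, shows that a number without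
   set bits is 0. *)
have [a0|a0] := posnP a; last exact: IH (ltn_Pdiv (ltnSn 1) a0) _ h1.
rewrite {}a0 {IH a h0 h} div0n in h1 *.
move: (b %/ 2) h1 => {}b; elim/ltn_ind: b => b IH h.
have [//|b0] := posnP b.
have hb : 0 = b %/ 2.
  by apply: IH (ltn_Pdiv (ltnSn 1) b0) _ => k; rewrite -bitS -h /bit !div0n.
rewrite -[b]odd_double_half -divn2 -hb addn0.
by have := h 0; rewrite /bit div0n divn1 /= => <-.
Qed.

Lemma bit_add b j k : ~~ bit b j -> bit (b + 2 ^ j) k = bit b k (+) (k == j).
Proof.
move=> bj; case: (ltngtP k j) => [kj|jk|->] /=.
- rewrite /bit -(subnK (ltnW kj)) expnD addnC divnMDl ?expn_gt0 // oddD oddX.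
  by rewrite subn_eq0 leqNgt kj /= addbF.
- have [s ->] : exists s, k = j + s.+1 by exists (k - j.+1); lia.
  rewrite addbF /bit expnD !divnMA -{1}[2 ^ j]mul1n addnC divnMDl ?expn_gt0 //.
  rewrite expnS !divnMA; congr (odd (_ %/ _)).
  (* b / 2^j is even, so adding 1 leaves its half unchanged: no carry reaches the higher bits. *)
  by move: bj; rewrite /bit; lia.
- by rewrite /bit -{1}[2 ^ j]mul1n addnC divnMDl ?expn_gt0 // oddD addbC.
Qed.

Lemma bit_sub b j k : bit b j -> bit (b - 2 ^ j) k = bit b k (+) (k == j).
Proof.
move=> bj.
have le : 2 ^ j <= b.
  by rewrite leqNgt; apply/negP => /divn_small E; move: bj; rewrite /bit E.
have nb : ~~ bit (b - 2 ^ j) j.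
  have E : b %/ 2 ^ j = 1 + (b - 2 ^ j) %/ 2 ^ j.
    by rewrite -divnMDl ?expn_gt0 // mul1n subnKC.
  by move: bj; rewrite /bit E oddD.
by have := bit_add k nb; rewrite subnK // => ->; rewrite -addbA addbb addbF.
Qed.

Lemma bit_small b n : b < 2 ^ n -> forall k, n <= k -> bit b k = false.
Proof.
move=> bn k nk; rewrite /bit divn_small //.
by apply: leq_trans bn _; rewrite leq_exp2l.
Qed.

Definition flipn j b := if bit b j then b - 2 ^ j else b + 2 ^ j.

Lemma bit_flipn j b k : bit (flipn j b) k = bit b k (+) (k == j).
Proof. by rewrite /flipn; case: ifPn => h; [exact: bit_sub|exact: bit_add]. Qed.

Lemma flipnK j : involutive (flipn j).
Proof. by move=> b; apply: bit_inj => k; rewrite !bit_flipn -addbA addbb addbF. Qed.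

Lemma flipnC j k b : flipn j (flipn k b) = flipn k (flipn j b).
Proof. by apply: bit_inj => i; rewrite !bit_flipn -!addbA (addbC (i == k)). Qed.

Lemma flipn_lt n j b : j < n -> b < 2 ^ n -> flipn j b < 2 ^ n.
Proof.
move=> jn bn; rewrite /flipn; case: ifPn => bj.
  exact: leq_ltn_trans (leq_subr _ _) bn.
rewrite ltnNge; apply/negP => le.
have : bit (b + 2 ^ j) n = false.
  by rewrite bit_add // (bit_small bn (leqnn n)) (gtn_eqF jn).
have jn2 : 2 ^ j < 2 ^ n by rewrite ltn_exp2l.
have -> : b + 2 ^ j = 1 * 2 ^ n + (b + 2 ^ j - 2 ^ n) by rewrite mul1n subnKC.
by rewrite /bit divnMDl ?expn_gt0 // divn_small //; lia.
Qed.

End Bits.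

Section Fock.
Variable R : realType.
Local Notation C := (R[i]).
Variable n : nat.
Local Notation idx := 'I_(2 ^ n).
Implicit Types (r c : idx) (v : 'cV[C]_(2 ^ n)).

Definition flip (j : 'I_n) (r : idx) : idx := Ordinal (flipn_lt (ltn_ord j) (ltn_ord r)).

Lemma flipK j : involutive (flip j).
Proof. by move=> r; apply: val_inj; exact: flipnK. Qed.

Lemma flipC j k r : flip j (flip k r) = flip k (flip j r).
Proof. by apply: val_inj; exact: flipnC. Qed.

Lemma bit_flip j r k : bit (flip j r) k = bit r k (+) (k == j).
Proof. exact: bit_flipn. Qed.

(** The Jordan-Wigner sign of orbital j. *)
Definition parity (j : nat) (r : nat) : C := (-1) ^+ (\sum_(k < j) bit r k).

Lemma parity_flip j k r : parity j (flip k r) = parity j r * (-1) ^+ (k < j)%N.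
Proof.
rewrite /parity; elim: j => [|j IH]; first by rewrite !big_ord0 mulr1.
rewrite !big_ord_recr /= !exprD IH bit_flip ltnS (leq_eqVlt k j).
rewrite (eq_sym j); case: (ltngtP k j) => jk /=; rewrite ?addbF ?addbT ?expr0 ?mulr1 //.
  by rewrite mulrAC.
by case: (bit r j); rewrite /= ?expr0 ?expr1 ?mulr1 ?mulrN1 ?opprK.
Qed.

Lemma parity_sq j r : parity j r * parity j r = 1.
Proof. by rewrite -expr2 sqrr_sign. Qed.

Lemma parity_conj j r : (parity j r)^* = parity j r.
Proof. by rewrite /parity rmorphXn rmorphN1. Qed.

Lemma occ_bitE b j : occ_bit b j = bit b j.
Proof. by []. Qed.

(** Indexed by the row: the only contributing column is [flip j r], and the sign may be read at r
    because both indices have the same bits below j. *)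
Lemma AdagE (j : 'I_n) r c :
  Adag R j r c = if bit r j && (c == flip j r) then parity j r else 0.
Proof.
rewrite mxE; have -> : (occ_bit c j == 0%N) && (nat_of_ord r == (c + 2 ^ j)%N)
    = bit r j && (c == flip j r).
  apply/andP/andP => [[]|[rj /eqP ->]].
    rewrite occ_bitE eqb0 => cj /eqP rE; rewrite rE bit_add // (negbTE cj) eqxx.
    split=> //; apply/eqP/val_inj; rewrite /= /flipn rE bit_add // (negbTE cj) eqxx /=.
    by rewrite addnK.
  rewrite occ_bitE bit_flip rj eqxx /= /flipn rj subnK //.
  by rewrite leqNgt; apply/negP => /divn_small E; move: rj; rewrite /bit E.
case: ifP => // /andP[_ /eqP ->].
by rewrite -/(parity j _) parity_flip ltnn mulr1.
Qed.

Lemma AopE (j : 'I_n) r c :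
  Aop R j r c = if ~~ bit r j && (c == flip j r) then parity j r else 0.
Proof.
rewrite adjE AdagE; have -> : bit c j && (r == flip j c) = ~~ bit r j && (c == flip j r).
  apply/andP/andP => [[h /eqP E]|[h /eqP E]]; rewrite E bit_flip ?flipK eqxx.
    by rewrite addbT h.
  by rewrite addbT (negbTE h).
case: ifP => [/andP[_ /eqP ->]|_]; last by rewrite rmorph0.
by rewrite parity_conj parity_flip ltnn mulr1.
Qed.

Implicit Types j k x y : 'I_n.

Lemma Adag_mul j v r :
  (Adag R j *m v) r 0 = if bit r j then parity j r * v (flip j r) 0 else 0.
Proof.
rewrite mxE (bigD1 (flip j r)) //= AdagE eqxx andbT big1 ?addr0 => [|c cr].
  by case: ifP => _; rewrite ?mul0r.
by rewrite AdagE (negbTE cr) andbF mul0r.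
Qed.

Lemma Aop_mul j v r :
  (Aop R j *m v) r 0 = if ~~ bit r j then parity j r * v (flip j r) 0 else 0.
Proof.
rewrite mxE (bigD1 (flip j r)) //= AopE eqxx andbT big1 ?addr0 => [|c cr].
  by case: ifP => _; rewrite ?mul0r.
by rewrite AopE (negbTE cr) andbF mul0r.
Qed.

Lemma mx_vec_ext (m k : nat) (A B : 'M[C]_(m, k)) :
  (forall (v : 'cV[C]_k) i, (A *m v) i 0 = (B *m v) i 0) -> A = B.
Proof.
move=> h; apply/matrixP => i j; have := h (delta_mx j 0) i.
by rewrite -!colE !mxE.
Qed.

(** Exactly one of j < k and k < j holds, so one order of flipping picks up an extra sign: the
    source of the anticommutation relations. *)
Lemma sign_lt_neq (j k : 'I_n) : j != k ->
  (-1) ^+ (j < k)%N = - (-1) ^+ (k < j)%N :> C.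
Proof.
by rewrite -val_eqE /=; case: ltngtP => //= _ _; rewrite ?opprK.
Qed.

Lemma Aop_anticomm j k : Aop R j *m Aop R k = - (Aop R k *m Aop R j).
Proof.
apply: mx_vec_ext => v r; rewrite mulNmx [RHS]mxE -!mulmxA !(Aop_mul, bit_flip) (flipC k).
have [->|jk] := eqVneq j k.
  by case: (bit r k); rewrite !eqxx /= ?mulr0 oppr0.
rewrite !(inj_eq val_inj) (eq_sym k) (negbTE jk) !addbF !parity_flip.
case: (bit r j); case: (bit r k); rewrite /= ?mulr0 ?oppr0 //.
rewrite (sign_lt_neq jk); ring.
Qed.

Lemma Aop_Adag j k :
  Aop R j *m Adag R k = (j == k)%:R%:M - Adag R k *m Aop R j.
Proof.
apply: mx_vec_ext => v r; rewrite mulmxBl [RHS]mxE [X in _ + X]mxE -!mulmxA mul_scalar_mx.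
rewrite !(Aop_mul, Adag_mul, bit_flip) (flipC k) [(_ *: v) r 0]mxE.
have [->|jk] := eqVneq j k.
  rewrite !eqxx flipK !parity_flip ltnn !mulr1 !addbT.
  case: (bit r k); rewrite /= ?mulr0 mul1r mulrA parity_sq mul1r; ring.
rewrite !(inj_eq val_inj) (eq_sym k) (negbTE jk) !addbF !parity_flip mul0r add0r.
case: (bit r j); case: (bit r k); rewrite /= ?mulr0 ?oppr0 //.
rewrite (sign_lt_neq jk); ring.
Qed.

Lemma Adag_anticomm j k : Adag R j *m Adag R k = - (Adag R k *m Adag R j).
Proof.
have := congr1 (@adj R _ _) (Aop_anticomm k j).
by rewrite adjN !adjM /Aop !adjK.
Qed.

Definition bil (j k : 'I_n) : 'M[C]_(2 ^ n) := Adag R j *m Aop R k.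

Lemma Aop_bil x j k :
  Aop R x *m bil j k = bil j k *m Aop R x + (x == j)%:R *: Aop R k.
Proof.
rewrite /bil mulmxA Aop_Adag mulmxBl mul_scalar_mx -!mulmxA (Aop_anticomm x k).
by rewrite mulmxN opprK addrC.
Qed.

Lemma Aop_bil_comm x j k : x != j -> Aop R x *m bil j k = bil j k *m Aop R x.
Proof. by rewrite Aop_bil => /negbTE ->; rewrite scale0r addr0. Qed.

Lemma Adag_bil_comm x j k : x != k -> Adag R x *m bil j k = bil j k *m Adag R x.
Proof.
move=> xk; rewrite /bil mulmxA Adag_anticomm -[RHS]mulmxA Aop_Adag.
rewrite eq_sym (negbTE xk) raddf0 sub0r mulmxN mulNmx mulmxA.
by [].
Qed.

(** Each factor passes an even operator on other sites, so its two signs cancel. Locality can thus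
    be expressed by commutators although the fermionic operators anticommute. *)
Lemma bil_comm j k j' k' : [disjoint [set j; k] & [set j'; k']] ->
  bil j k *m bil j' k' = bil j' k' *m bil j k.
Proof.
move=> d.
have dd x y : x \in [set j; k] -> y \in [set j'; k'] -> x != y.
  by move=> hx hy; apply/eqP => E; move: (disjointFr d hx); rewrite E hy.
have h1 := @Aop_bil_comm k j' k' (dd _ _ (set22 _ _) (set21 _ _)).
have h2 := @Adag_bil_comm j j' k' (dd _ _ (set21 _ _) (set22 _ _)).
by rewrite {1 4}/bil -mulmxA h1 mulmxA h2 -mulmxA.
Qed.

Lemma Nop_bil j : Nop R j = bil j j.
Proof. by []. Qed.

Lemma TE (tau : 'M[C]_n) : Tham tau = \sum_j \sum_k tau j k *: bil j k.
Proof. by []. Qed.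

(** [A_x, T] is again a combination of annihilators, with row x of tau as coefficients: T acts on
    annihilators as tau acts on one particle. *)
Lemma Aop_T tau x : Aop R x *m Tham tau =
  Tham tau *m Aop R x + \sum_k tau x k *: Aop R k.
Proof.
rewrite TE mulmx_sumr mulmx_suml.
rewrite (eq_bigr (fun j => (\sum_k tau j k *: bil j k) *m Aop R x +
     \sum_k (tau j k * (x == j)%:R) *: Aop R k)) => [|j _].
  rewrite big_split /=; congr (_ + _); rewrite (bigD1 x) //=.
  rewrite [X in _ + X]big1 => [|j jx].
    by rewrite addr0; apply: eq_bigr => k _; rewrite eqxx mulr1.
  by rewrite big1 // => k _; rewrite eq_sym (negbTE jx) mulr0 scale0r.
rewrite mulmx_sumr mulmx_suml -big_split /=; apply: eq_bigr => k _.
by rewrite -scalemxAr Aop_bil scalerDr scalerA scalemxAl.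
Qed.

End Fock.

(** * Sectors of fixed electron number *)

Section Sector.
Variable R : realType.
Local Notation C := (R[i]).
Variable n : nat.
Local Notation idx := 'I_(2 ^ n).
Implicit Types (r c : idx) (v : 'cV[C]_(2 ^ n)) (j k x : 'I_n) (eta : nat).

Lemma occ_numE (r : nat) : occ_num n r = (\sum_(j < n) bit r j)%N.
Proof. by []. Qed.

Lemma occ_flip j r : (occ_num n (flip j r) + bit r j = occ_num n r + ~~ bit r j)%N.
Proof.
rewrite !occ_numE (bigD1 j) //= [in RHS](bigD1 j) //= bit_flip eqxx addbT.
rewrite (eq_bigr (fun i : 'I_n => bit r i : nat)) => [|i ij].
  lia.
by rewrite bit_flip (inj_eq val_inj) (negbTE ij) addbF.
Qed.

Definition in_sector eta v := forall b : idx, occ_num n b != eta -> v b 0 = 0.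

Definition sector_proj eta : 'M[C]_(2 ^ n) :=
  \matrix_(r, c) ((r == c) && (occ_num n r == eta))%:R.

Lemma sector_proj_mul eta v r :
  (sector_proj eta *m v) r 0 = if occ_num n r == eta then v r 0 else 0.
Proof.
rewrite mxE (bigD1 r) //= mxE eqxx big1 ?addr0 => [|c cr].
  by case: ifP; rewrite ?mul1r ?mul0r.
by rewrite mxE eq_sym (negbTE cr) mul0r.
Qed.

Lemma sector_projP eta v : in_sector eta v <-> sector_proj eta *m v = v.
Proof.
split=> [h|h b nb]; last by rewrite -h sector_proj_mul (negbTE nb).
apply/matrixP => r i; rewrite ord1 sector_proj_mul; case: ifPn => // nb.
by rewrite h.
Qed.

Lemma bil_mul j k v r : (bil R j k *m v) r 0 =
  if bit r j && ~~ bit (flip j r) k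
  then parity R j r * parity R k (flip j r) * v (flip k (flip j r)) 0 else 0.
Proof.
rewrite -mulmxA Adag_mul Aop_mul; case: (bit r j) => //=; case: ifP => //= _.
  by rewrite mulrA.
by rewrite mulr0.
Qed.

Lemma occ_bil j k r : bit r j -> ~~ bit (flip j r) k ->
  occ_num n (flip k (flip j r)) = occ_num n r.
Proof.
move=> h1 h2; have := occ_flip j r; have := occ_flip k (flip j r).
by rewrite h1 (negbTE h2); lia.
Qed.

Lemma sector_proj_bil eta j k :
  sector_proj eta *m bil R j k = bil R j k *m sector_proj eta.
Proof.
apply: mx_vec_ext => v r.
rewrite -(mulmxA (sector_proj eta)) -(mulmxA (bil R j k)) sector_proj_mul !bil_mul.
case: ifP => [E|E]; case: ifP => //= /andP[h1 h2]; rewrite sector_proj_mul occ_bil // E //.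
by rewrite mulr0.
Qed.

Lemma sector_proj_T eta tau : sector_proj eta *m Tham tau = Tham tau *m sector_proj eta.
Proof.
apply: comm_mx_bigsum => j; apply: comm_mx_bigsum => k.
by apply: comm_mx_scale; exact: sector_proj_bil.
Qed.

Lemma sector_proj_V eta nu : sector_proj eta *m Vham nu = Vham nu *m sector_proj eta.
Proof.
apply: comm_mx_bigsum => j; apply: comm_mx_bigsum => k.
apply: comm_mx_scale; apply: comm_mx_mul; exact: sector_proj_bil.
Qed.

Definition vac : idx := Ordinal (etrans (expn_gt0 2 n) isT).

(** A product of annihilators under the vacuum bra, the head of s acting first. Its value on a
    vector is the wave function of [size s] particles at the positions s; a repeated position gives
    0 by anticommutation. *)
Fixpoint bra (s : seq 'I_n) : 'rV[C]_(2 ^ n) :=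
  if s is j :: s' then bra s' *m Aop R j else delta_mx 0 vac.

Lemma bit_vac j : bit vac j = false.
Proof. by rewrite /bit /= div0n. Qed.

Lemma bra_nil_Adag j : bra [::] *m Adag R j = 0.
Proof.
apply/matrixP => i c; rewrite -rowE [RHS]mxE [LHS]mxE AdagE.
by rewrite bit_vac.
Qed.

Lemma bra_nil_bil j k : bra [::] *m bil R j k = 0.
Proof. by rewrite /bil mulmxA bra_nil_Adag mul0mx. Qed.

(** T moves left past the annihilators, leaving by [Aop_T] one hopping term per particle, until the
    vacuum absorbs it. The default of [nth] is never reached, as a < size s. *)
Lemma bra_T tau s : bra s *m Tham tau =
  \sum_(a < size s) \sum_k tau (nth k s a) k *: bra (set_nth k s a k).
Proof.
elim: s => [|x s IH].
  rewrite big_ord0 TE mulmx_sumr big1 // => j _; rewrite mulmx_sumr big1 // => k _.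
  by rewrite -scalemxAr bra_nil_bil scaler0.
rewrite [bra (x :: s)]/= -mulmxA Aop_T mulmxDr mulmxA IH [RHS]big_ord_recl /= addrC.
congr (_ + _).
  by rewrite mulmx_sumr; apply: eq_bigr => k _; rewrite -scalemxAr.
rewrite mulmx_suml; apply: eq_bigr => a _.
by rewrite mulmx_suml; apply: eq_bigr => k _; rewrite -scalemxAl.
Qed.

Lemma bra_N s x : bra s *m Nop R x = (count_mem x s)%:R *: bra s.
Proof.
rewrite Nop_bil; elim: s => [|y s IH]; first by rewrite bra_nil_bil scale0r.
have -> : (count_mem x (y :: s))%:R = (y == x)%:R + (count_mem x s)%:R :> C.
  by rewrite /= natrD.
rewrite [bra (y :: s)]/= -mulmxA Aop_bil mulmxDr mulmxA IH scalerDl addrC.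
congr (_ + _); last by rewrite -scalemxAl.
by case: eqP => [->|_]; rewrite ?scale0r ?mulmx0 ?scale1r.
Qed.

Lemma bra_V nu s : bra s *m Vham nu =
  (\sum_l \sum_m nu l m * ((count_mem l s)%:R * (count_mem m s)%:R)) *: bra s.
Proof.
rewrite /Vham mulmx_sumr scaler_suml; apply: eq_bigr => l _.
rewrite mulmx_sumr scaler_suml; apply: eq_bigr => m _.
by rewrite -scalemxAr mulmxA bra_N -scalemxAl bra_N !scalerA mulrA.
Qed.

Lemma occ0_vac r : occ_num n r = 0%N -> r = vac.
Proof.
rewrite occ_numE => /eqP; rewrite sum_nat_eq0 => /forallP h.
apply: val_inj; apply: bit_inj => k /=; rewrite [RHS]/bit div0n /=.
case: (ltnP k n) => kn; last exact: bit_small (ltn_ord r) _ kn.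
by have := h (Ordinal kn); rewrite implyTb eqb0 => /negbTE.
Qed.

Lemma in_sector_Aop eta j v : in_sector eta.+1 v -> in_sector eta (Aop R j *m v).
Proof.
move=> hv b nb; rewrite Aop_mul; case: ifP => // bj; rewrite hv ?mulr0 //.
by have := occ_flip j b; rewrite bj (negbTE bj); lia.
Qed.

(** The left side is the expectation of the total number operator, which equals eta on the
    sector. *)
Lemma sum_Aop_norm eta v : in_sector eta v ->
  \sum_j vnorm (Aop R j *m v) ^+ 2 = eta%:R * vnorm v ^+ 2.
Proof.
move=> hv; rewrite sqr_vnorm mulr_sumr.
transitivity (\sum_(j < n) \sum_(r : idx) (bit r j)%:R * cnorm (v r 0) ^+ 2).
  apply: eq_bigr => j _; rewrite sqr_vnorm (reindex_inj (can_inj (flipK j))) /=.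
  apply: eq_bigr => r _; rewrite Aop_mul bit_flip eqxx addbT negbK flipK.
  case: (bit r j); rewrite ?mul1r ?mul0r ?cnorm0 ?expr0n //.
  rewrite cnormM exprMn -[X in _ = X]mul1r; congr (_ * _).
  by rewrite /parity cnormX cnormN cnorm1 expr1n expr1n.
rewrite exchange_big /=; apply: eq_bigr => r _; rewrite -mulr_suml.
have [E|E] := eqVneq (occ_num n r) eta; last by rewrite hv // cnorm0 expr0n !mulr0.
by rewrite -E occ_numE natr_sum.
Qed.

Lemma sum_tuple_cons (eta : nat) (F : seq 'I_n -> R) :
  \sum_(t : eta.+1.-tuple 'I_n) F t = \sum_j \sum_(t : eta.-tuple 'I_n) F (j :: t).
Proof.
rewrite pair_big /=.
rewrite (reindex (fun p : 'I_n * eta.-tuple 'I_n => [tuple of p.1 :: p.2])) //=.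
exists (fun t : eta.+1.-tuple 'I_n => (thead t, [tuple of behead t])) => [[j t]|t] _ /=.
  by congr (_, _); apply: val_inj.
by rewrite -tuple_eta.
Qed.

(** Peeling off one annihilator passes to the sector below, and [sum_Aop_norm] contributes the
    current particle number; these factors multiply to the factorial. *)
Lemma bra_isometry eta v : in_sector eta v ->
  \sum_(t : eta.-tuple 'I_n) cnorm ((bra t *m v) 0 0) ^+ 2 = eta`!%:R * vnorm v ^+ 2.
Proof.
elim: eta v => [|eta IH] v hv.
  rewrite (big_pred1 [tuple]) => [|t]; last by apply/esym/eqP; exact: tuple0.
  rewrite /= fact0 mul1r -rowE mxE sqr_vnorm (bigD1 vac) //= big1 ?addr0 // => r rv.
  rewrite hv ?cnorm0 ?expr0n //; apply: contra rv => /eqP/occ0_vac ->.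
  by [].
rewrite (sum_tuple_cons eta (fun s => cnorm ((bra s *m v) 0 0) ^+ 2)).
rewrite factS natrM mulrAC -(sum_Aop_norm hv) mulr_suml.
apply: eq_bigr => j _; rewrite mulrC -IH; last exact: in_sector_Aop.
by apply: eq_bigr => t _; rewrite /= mulmxA.
Qed.

End Sector.

(** * First quantization: terms acting on particles *)

Section CoefficientNorms.
Variable R : realType.
Local Notation C := (R[i]).

Lemma spec_norm_ub m (A : 'M[C]_m) (v : 'cV[C]_m) : vnorm (A *m v) <= spec_norm A * vnorm v.
Proof.
have [v0|v0] := eqVneq (vnorm v) 0.
  by rewrite (vnorm_eq0 v0) mulmx0 vnorm0 mulr0.
have vp : 0 < vnorm v by rewrite lt_def v0 vnorm_ge0.
have vi : 0 <= (vnorm v)^-1 by rewrite invr_ge0 vnorm_ge0.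
pose u := ((vnorm v)^-1)%:C%C *: v.
have nu : vnorm u = 1.
  by rewrite vnormZ cnorm_real ger0_norm // mulVf.
have Au : vnorm (A *m u) <= spec_norm A.
  apply: ub_le_sup; last by exists u.
  have [K K0 hK] := opb_bounded 1%:M A.
  exists K => _ [x [x1 ->]]; have := hK x (mul1mx _).
  by rewrite x1 mulr1.
rewrite -ler_pdivrMr //; apply: le_trans Au.
by rewrite /u -scalemxAr vnormZ cnorm_real ger0_norm // mulrC.
Qed.

Lemma spec_norm_ge0 m (A : 'M[C]_m.+1) : 0 <= spec_norm A.
Proof.
apply: le_trans (vnorm_ge0 (A *m delta_mx 0 0)) _.
by apply: le_trans (spec_norm_ub _ _) _; rewrite vnorm_delta mulr1.
Qed.

Lemma max_norm_ub m (A : 'M[C]_m) i j : cnorm (A i j) <= max_norm A.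
Proof.
rewrite /max_norm; apply: (@le_trans _ _ (\big[Num.max/0]_(k < m) cnorm (A i k))).
  exact: (le_bigmax _ (fun k => cnorm (A i k))).
exact: (le_bigmax _ (fun i => \big[Num.max/0]_(k < m) cnorm (A i k))).
Qed.

Lemma max_norm_ge0 m (A : 'M[C]_m) : 0 <= max_norm A.
Proof. exact: bigmax_ge_id. Qed.

End CoefficientNorms.

(** * The space of eta distinguishable particles *)

Section FirstQuantization.
Variable R : realType.
Local Notation C := (R[i]).
Variables (n eta : nat) (tau nu : 'M[C]_n).
Hypothesis n0 : (0 < n)%N.
Local Notation X := (eta.-tuple 'I_n).
Local Notation N := #|{: X}|.
Implicit Types (t : X) (a : 'I_eta) (k : 'I_n) (b : bool).

Definition upd t a k : X := [tuple if i == a then k else tnth t i | i < eta].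

Lemma tnth_upd t a k a' : tnth (upd t a k) a' = if a' == a then k else tnth t a'.
Proof. exact: tnth_mktuple. Qed.

Lemma val_upd t a k : upd t a k = set_nth k t a k :> seq _.
Proof.
apply: (@eq_from_nth _ k); first by rewrite size_set_nth !size_tuple; apply/esym/maxn_idPr.
move=> i; rewrite size_tuple => ie; rewrite nth_set_nth /=.
by rewrite -(tnth_nth k (upd t a k) (Ordinal ie)) tnth_upd -val_eqE /= (tnth_nth k).
Qed.

Lemma updC t a a' k l : a != a' -> upd (upd t a k) a' l = upd (upd t a' l) a k.
Proof.
move=> ab; apply: eq_from_tnth => i; rewrite !tnth_upd.
by case: (eqVneq i a') => [->|//]; rewrite eq_sym (negbTE ab).
Qed.

Lemma upd_upd t a k l : upd (upd t a k) a l = upd t a l.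
Proof. by apply: eq_from_tnth => i; rewrite !tnth_upd; case: eqP. Qed.

Lemma upd_id t a : upd t a (tnth t a) = t.
Proof. by apply: eq_from_tnth => i; rewrite tnth_upd; case: eqP => [->|]. Qed.

(** The map (t, k) -> (upd t a k, tnth t a) is an involution on pairs and turns the double sum into
    n copies of the plain one. This avoids splitting tuples into coordinate a and the rest. *)
Lemma sum_upd (F : X -> R) a : \sum_t \sum_k F (upd t a k) = n%:R * \sum_t F t.
Proof.
rewrite pair_big (reindex (fun p : X * 'I_n => (upd p.1 a p.2, tnth p.1 a))) /=; last first.
  exists (fun p : X * 'I_n => (upd p.1 a p.2, tnth p.1 a)) => [] [t k] _ /=;
  by rewrite upd_upd upd_id tnth_upd eqxx.
rewrite -(pair_big predT predT (fun t k => F (upd (upd t a k) a (tnth t a)))) /=.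
rewrite mulr_sumr; apply: eq_bigr => t _.
under eq_bigr => k _ do rewrite upd_upd upd_id.
by rewrite sumr_const card_ord mulr_natl.
Qed.

Local Notation "v .at t" := (v (enum_rank t) 0) (at level 5).

(** The matrix tau on tensor factor a of the eta-fold power of C^n, in the basis of tuples. Without
    antisymmetrization, distinct factors act independently. *)
Definition tau1 a : 'M[C]_N := \matrix_(i, j)
  \sum_k tau (tnth (enum_val i) a) k * (enum_val j == upd (enum_val i) a k)%:R.

Definition nu1 a a' : 'M[C]_N := \matrix_(i, j)
  (nu (tnth (enum_val i) a) (tnth (enum_val i) a') * (i == j)%:R).

Lemma tau1_mul a (v : 'cV[C]_N) i : (tau1 a *m v) i 0 =
  \sum_k tau (tnth (enum_val i) a) k * v (enum_rank (upd (enum_val i) a k)) 0.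
Proof.
rewrite mxE; under eq_bigr => j _ do rewrite mxE mulr_suml.
rewrite exchange_big /=; apply: eq_bigr => k _.
rewrite (bigD1 (enum_rank (upd (enum_val i) a k))) //= enum_rankK eqxx mulr1.
rewrite big1 ?addr0 // => j jk.
case: eqP => [E|_]; last by rewrite mulr0 mul0r.
by move: jk; rewrite -E enum_valK eqxx.
Qed.

Lemma nu1_mul a a' (v : 'cV[C]_N) i : (nu1 a a' *m v) i 0 =
  nu (tnth (enum_val i) a) (tnth (enum_val i) a') * v i 0.
Proof.
rewrite mxE (bigD1 i) //= mxE eqxx mulr1 big1 ?addr0 // => j ji.
by rewrite mxE eq_sym (negbTE ji) mulr0 mul0r.
Qed.

Lemma tau1_comm a a' : a != a' -> tau1 a *m tau1 a' = tau1 a' *m tau1 a.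
Proof.
move=> ab; apply: mx_vec_ext => v i; rewrite -!mulmxA !tau1_mul.
under eq_bigr => k _ do rewrite tau1_mul enum_rankK mulr_sumr.
under [RHS]eq_bigr => k _ do rewrite tau1_mul enum_rankK mulr_sumr.
rewrite exchange_big /=; apply: eq_bigr => l _; apply: eq_bigr => k _.
rewrite !tnth_upd (negbTE ab) eq_sym (negbTE ab) updC // mulrCA.
by [].
Qed.

Lemma tau1_nu1_comm a x y : a != x -> a != y -> tau1 a *m nu1 x y = nu1 x y *m tau1 a.
Proof.
move=> ab ac; apply: mx_vec_ext => v i; rewrite -!mulmxA tau1_mul nu1_mul tau1_mul mulr_sumr.
apply: eq_bigr => k _; rewrite nu1_mul enum_rankK !tnth_upd.
by rewrite eq_sym (negbTE ab) eq_sym (negbTE ac) mulrCA.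
Qed.

Lemma nu1_comm x y x' y' : nu1 x y *m nu1 x' y' = nu1 x' y' *m nu1 x y.
Proof. by apply: mx_vec_ext => v i; rewrite -!mulmxA !nu1_mul mulrCA. Qed.

Lemma opb_nu1 x y : opb 1%:M (nu1 x y) (max_norm nu).
Proof.
move=> v _; apply: ler_sqr_wp; first by rewrite mulr_ge0 ?vnorm_ge0 ?max_norm_ge0.
rewrite exprMn !sqr_vnorm mulr_sumr; apply: ler_sum => i _.
rewrite nu1_mul cnormM exprMn; apply: ler_wpM2r; first exact: sqr_ge0.
by rewrite lerXn2r ?nnegrE ?cnorm_ge0 ?max_norm_ge0 // max_norm_ub.
Qed.

Lemma opb_tau1 a : opb 1%:M (tau1 a) (spec_norm tau).
Proof.
have s0 : 0 <= spec_norm tau by case: (n) tau n0 => // n' tau' _; exact: spec_norm_ge0.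
move=> v _; apply: ler_sqr_wp; first by rewrite mulr_ge0 ?vnorm_ge0.
have nr : 0 < n%:R :> R by rewrite ltr0n.
(* By [sum_upd], n times the squared norm is a sum over fibres on which only coordinate a varies; on
   each fibre [tau1 a] acts as tau on the vector u below. *)
rewrite -(ler_pM2l nr) exprMn !sqr_vnorm.
have reidx (F : 'I_N -> R) : \sum_i F i = \sum_t F (enum_rank t).
  by rewrite (reindex _ (onW_bij _ (@enum_rank_bij X))).
rewrite !reidx -(sum_upd _ a) mulrCA -(sum_upd (fun t => cnorm (v (enum_rank t) 0) ^+ 2) a).
rewrite mulr_sumr; apply: ler_sum => t _.
pose u : 'cV[C]_n := \col_k v (enum_rank (upd t a k)) 0.
have h : vnorm (tau *m u) ^+ 2 <= spec_norm tau ^+ 2 * vnorm u ^+ 2.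
  by rewrite -exprMn lerXn2r ?nnegrE ?mulr_ge0 ?vnorm_ge0 ?spec_norm_ub.
rewrite !sqr_vnorm in h; apply: le_trans (le_trans h _).
  rewrite le_eqVlt; apply/orP; left; apply/eqP; apply: eq_bigr => k _.
  rewrite tau1_mul enum_rankK tnth_upd eqxx [in RHS]mxE; congr (cnorm _ ^+ 2).
  by apply: eq_bigr => l _; rewrite upd_upd mxE.
rewrite le_eqVlt; apply/orP; left; apply/eqP; congr (_ * _).
by apply: eq_bigr => k _; rewrite mxE.
Qed.

(* Row [t] is the bra <0| A_{t_eta} .. A_{t_1}: up to the factor sqrt(eta!)
   this embeds the sector isometrically into the space of eta distinguishable
   particles. *)
Definition slater : 'M[C]_(N, 2 ^ n) := \matrix_(i < N, c < 2 ^ n) bra R (enum_val i : X) 0 c.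

Lemma slater_mul (v : 'cV[C]_(2 ^ n)) i :
  (slater *m v) i 0 = (bra R (enum_val i : X) *m v) 0 0.
Proof. by rewrite [LHS]mxE [RHS]mxE; apply: eq_bigr => c _; rewrite mxE. Qed.

Lemma slater_T : slater *m Tham tau = (\sum_a tau1 a) *m slater.
Proof.
apply: mx_vec_ext => v i; rewrite -!mulmxA slater_mul mulmxA bra_T.
set t : X := enum_val i.
rewrite -(big_mkord xpredT (fun q : nat => \sum_k tau (nth k t q) k *: bra R (set_nth k t q k))).
rewrite size_tuple big_mkord !mulmx_suml !summxE; apply: eq_bigr => a _.
rewrite tau1_mul mulmx_suml summxE; apply: eq_bigr => k _.
rewrite slater_mul enum_rankK val_upd -scalemxAl mxE (tnth_nth k).
by [].
Qed.

Lemma count_mem_tuple k t : (count_mem k t)%:R = \sum_a (tnth t a == k)%:R :> C.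
Proof.
rewrite -sum1_count big_tuple natr_sum big_mkcond; apply: eq_bigr => a _ /=.
by case: eqP.
Qed.

Lemma slater_V : slater *m Vham nu = (\sum_x \sum_y nu1 x y) *m slater.
Proof.
apply: mx_vec_ext => v i; rewrite -!mulmxA slater_mul mulmxA bra_V.
rewrite -scalemxAl mxE -slater_mul mulmx_suml summxE.
transitivity (\sum_x \sum_y nu (tnth (enum_val i) x) (tnth (enum_val i) y) * (slater *m v) i 0).
  under [RHS]eq_bigr => a _ do rewrite -mulr_suml.
  rewrite -mulr_suml; congr (_ * _).
  transitivity (\sum_l \sum_m \sum_x \sum_y
     nu l m * ((tnth (enum_val i) x == l)%:R * (tnth (enum_val i) y == m)%:R)).
    apply: eq_bigr => l _; apply: eq_bigr => m _.
    rewrite !count_mem_tuple mulr_suml mulr_sumr; apply: eq_bigr => a _.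
    by rewrite mulr_sumr mulr_sumr.
  under eq_bigr => l _ do rewrite exchange_big /=.
  rewrite exchange_big /=; apply: eq_bigr => a _.
  under eq_bigr => l _ do rewrite exchange_big /=.
  rewrite exchange_big /=; apply: eq_bigr => y _.
  rewrite (bigD1 (tnth (enum_val i) a)) //= [X in _ + X]big1 => [|l la].
    rewrite addr0 (bigD1 (tnth (enum_val i) y)) //= big1 => [|m mb].
      by rewrite !eqxx !mulr1 addr0.
    by rewrite [_ == m]eq_sym (negbTE mb) !mulr0.
  by rewrite big1 // => m _; rewrite [_ == l]eq_sym (negbTE la) mul0r mulr0.
apply: eq_bigr => a _; rewrite mulmx_suml summxE; apply: eq_bigr => y _.
by rewrite nu1_mul.
Qed.

Lemma slater_isometry v : in_sector eta v ->
  vnorm (slater *m v) ^+ 2 = eta`!%:R * vnorm v ^+ 2.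
Proof.
move=> hv; rewrite -bra_isometry // sqr_vnorm (reindex _ (onW_bij _ (@enum_rank_bij X))) /=.
by apply: eq_bigr => t _; rewrite slater_mul enum_rankK.
Qed.

Definition minus_i : C := - 'i%C.

Lemma cnorm_minus_i : cnorm minus_i = 1.
Proof. by rewrite cnormN cnorm_i. Qed.

Definition hamZ (b : bool) : 'M[C]_(2 ^ n) :=
  minus_i *: (if b then Tham tau else Vham nu).

(** One-particle terms sit on the diagonal pairs, so T and V share the indexing by pairs and a row
    of T weighs just |tau|. *)
Definition local1 (b : bool) (x y : 'I_eta) : 'M[C]_N :=
  minus_i *: (if b then (if x == y then tau1 x else 0) else nu1 x y).

Definition weight1 (b : bool) (x y : 'I_eta) : R :=
  if b then (if x == y then spec_norm tau else 0) else max_norm nu.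

Definition rate1 (b : bool) : R := if b then spec_norm tau else max_norm nu * eta%:R.

Lemma spec_tau_ge0 : 0 <= spec_norm tau.
Proof. by case: (n) tau n0 => // n' tau' _; exact: spec_norm_ge0. Qed.

Lemma opb_local1 b x y : opb 1%:M (local1 b x y) (weight1 b x y).
Proof.
rewrite -[weight1 b x y]mul1r -cnorm_minus_i; apply: opbZ; rewrite /weight1.
case: b; last exact: opb_nu1.
by case: eqP => _; [exact: opb_tau1|exact: opb0].
Qed.

Lemma opb1_commx (m : nat) (M M' : 'M[C]_m) c d : 0 <= c -> 0 <= d ->
  opb 1%:M M c -> opb 1%:M M' d -> opb 1%:M (commx M M') (2 * c * d).
Proof.
move=> c0 d0 hM hM'; rewrite (_ : 2 * c * d = c * d + d * c); last by ring.
by apply: opbB; apply: opbM => //; rewrite mulmx1 mul1mx.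
Qed.

Lemma commx_eq0 (m : nat) (A B : 'M[C]_m) (a b : C) :
  A *m B = B *m A -> commx (a *: A) (b *: B) = 0.
Proof. by move=> AB; rewrite commxZl commxZr /commx AB subrr !scaler0. Qed.

Lemma local1_comm b x y b' x' y' : [disjoint [set x; y] & [set x'; y']] ->
  commx (local1 b x y) (local1 b' x' y') = 0.
Proof.
move=> d.
have dd z z' : z \in [set x; y] -> z' \in [set x'; y'] -> z != z'.
  by move=> hx hy; apply/eqP => E; move: (disjointFr d hx); rewrite E hy.
have d11 := dd x x' (set21 _ _) (set21 _ _); have d12 := dd x y' (set21 _ _) (set22 _ _).
have d21 := dd y x' (set22 _ _) (set21 _ _).
apply: commx_eq0; case: b; case: b'.
- case: ifP => _; last by rewrite mulmx0 mul0mx.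
  case: ifP => _; last by rewrite mulmx0 mul0mx.
  exact: tau1_comm.
- by case: ifP => _; [exact: tau1_nu1_comm|rewrite mulmx0 mul0mx].
- case: ifP => _; last by rewrite mulmx0 mul0mx.
  by apply/esym/tau1_nu1_comm; rewrite eq_sym.
- exact: nu1_comm.
Qed.

Lemma weight1_row b x : \sum_y weight1 b x y <= rate1 b.
Proof.
case: b; rewrite /weight1 /rate1.
  by rewrite -big_mkcond (big_pred1 x) // => y; rewrite /= eq_sym.
by rewrite sumr_const card_ord mulr_natr.
Qed.

Lemma weight1_col b y : \sum_x weight1 b x y <= rate1 b.
Proof.
apply: le_trans (weight1_row b y); apply: ler_sum => x _.
by rewrite /weight1 eq_sym.
Qed.

Lemma slater_hamZ b : slater *m hamZ b = extsum local1 b *m slater.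
Proof.
rewrite /hamZ -scalemxAr /extsum.
have -> : \sum_x \sum_y local1 b x y =
    minus_i *: (if b then \sum_a tau1 a else \sum_x \sum_y nu1 x y).
  case: b; rewrite /local1 scaler_sumr; apply: eq_bigr => x _; rewrite -scaler_sumr //.
  by rewrite -big_mkcond (big_pred1 x) // => y; rewrite /= eq_sym.
by rewrite -scalemxAl; case: b; rewrite ?slater_T ?slater_V.
Qed.

Lemma slater_commx A B A' B' : slater *m A = A' *m slater -> slater *m B = B' *m slater ->
  slater *m commx A B = commx A' B' *m slater.
Proof.
move=> hA hB; rewrite /commx mulmxBr mulmxBl !mulmxA hA hB -!mulmxA hA hB.
by [].
Qed.

Lemma slater_adw u b :
  slater *m adw hamZ u (hamZ b) = adw (extsum local1) u (extsum local1 b) *m slater.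
Proof.
elim: u => [|c u IH] /=; first exact: slater_hamZ.
by apply: slater_commx => //; exact: slater_hamZ.
Qed.

Lemma opb_adw1 u b : opb 1%:M (adw (extsum local1) u (extsum local1 b))
  (eta%:R * (cst_local R (size u) * (\prod_(c <- u) rate1 c) * rate1 b)).
Proof.
have w0 c x y : 0 <= weight1 c x y.
  rewrite /weight1; case: c; last exact: max_norm_ge0.
  by case: ifP => // _; exact: spec_tau_ge0.
(* A nonempty support meets one of the eta sites, so the total weight is at most eta times the
   weight at a site. *)
pose kill (_ : 'M[C]_N) (S : {set 'I_eta}) : Prop := S != finset.set0.
have killh c x y : kill (local1 c x y) [set x; y].
  by apply/set0Pn; exists x; rewrite set21.
have killc c x y M S : kill M S -> kill (commx (local1 c x y) M) (S :|: [set x; y]).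
  by move=> /set0Pn[z zS]; apply/set0Pn; exists z; rewrite finset.in_setU zS.
have [l [-> hl hD]] := local_sum_adw w0 opb_local1 (@opb1_commx N) killh killc
  local1_comm weight1_row weight1_col u b.
set D := _ * _ * _ in hD *.
apply: (@opb_le _ _ _ _ (\sum_(s <- l) s.2.2)).
  have nn : {in l, forall s, 0 <= s.2.2} by move=> s /hl /lt_ge0.
  have := @sum_touching R 'I_eta _ l (fun s => s.2.1) (fun s => s.2.2) [set: 'I_eta] D nn hD.
  rewrite cardsT card_ord; apply: le_trans; rewrite big_seq [leRHS]big_seq_cond.
  rewrite le_eqVlt; apply/orP; left; apply/eqP; apply: eq_bigl => s.
  case sl: (s \in l) => //=; have := lt_kill (hl s sl).
  by rewrite -setI_eq0 finset.setIT.
move=> v _; rewrite mulmx_suml mulr_suml.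
apply: le_trans (vnorm_sum _ _ _) _; rewrite big_seq [leRHS]big_seq.
by apply: ler_sum => s sl; apply: (lt_nb (hl s sl)); rewrite mul1mx.
Qed.

(** [slater] scales norms on the sector by sqrt(eta!). The factor cancels because both v and M v lie
    in the sector, so the bound on tuples is inherited. *)
Lemma opb_adw_hamZ1 u b : opb (sector_proj R n eta) (adw hamZ u (hamZ b))
  (eta%:R * (cst_local R (size u) * (\prod_(c <- u) rate1 c) * rate1 b)).
Proof.
set K := _ * _; set M := adw _ _ _.
have K0 : 0 <= K.
  have r0 c : 0 <= rate1 c.
    by case: c; rewrite /rate1 ?spec_tau_ge0 // mulr_ge0 ?max_norm_ge0 ?ler0n.
  by rewrite !mulr_ge0 ?ler0n ?cst_local_ge0 // prodr_ge0.
have Zcomm c : sector_proj R n eta *m hamZ c = hamZ c *m sector_proj R n eta.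
  by apply: comm_mx_scale; case: c; [exact: sector_proj_T|exact: sector_proj_V].
have PM : sector_proj R n eta *m M = M *m sector_proj R n eta.
  rewrite /M; elim: (u) => [|c u' IH] /=; first exact: Zcomm.
  exact: comm_mx_commx.
move=> v Pv; have hv : in_sector eta v by apply/sector_projP.
have hMv : in_sector eta (M *m v) by apply/sector_projP; rewrite mulmxA PM -mulmxA Pv.
have f0 : 0 < eta`!%:R :> R by rewrite ltr0n fact_gt0.
apply: ler_sqr_wp; first by rewrite mulr_ge0 ?vnorm_ge0.
rewrite -(ler_pM2l f0) -slater_isometry // exprMn mulrCA -slater_isometry //.
rewrite -exprMn lerXn2r ?nnegrE ?vnorm_ge0 //; first exact: mulr_ge0 K0 (vnorm_ge0 _).
by rewrite mulmxA /M slater_adw -mulmxA; apply: opb_adw1; rewrite mul1mx.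
Qed.

End FirstQuantization.

(** * Sparse interactions: terms acting on orbitals *)

Section ColumnNorm.
Variable R : realType.
Local Notation C := (R[i]).
Variable m : nat.
Implicit Types M A B : 'M[C]_m.

(** A bound on the norm induced by l^1: submultiplicative, yet controlled one basis configuration at
    a time. *)
Definition col_bound A (K : R) := forall c, \sum_r cnorm (A r c) <= K.

Lemma col_boundM A B K L : 0 <= K -> col_bound A K -> col_bound B L ->
  col_bound (A *m B) (K * L).
Proof.
move=> K0 hA hB c.
apply: (@le_trans _ _ (\sum_r \sum_k cnorm (A r k) * cnorm (B k c))).
  apply: ler_sum => r _; rewrite mxE; apply: le_trans (cnorm_sum _ _ _) _.
  by rewrite le_eqVlt; apply/orP; left; apply/eqP; apply: eq_bigr => k _; rewrite cnormM.
rewrite exchange_big /=; apply: (@le_trans _ _ (\sum_k K * cnorm (B k c))).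
  apply: ler_sum => k _; rewrite -mulr_suml; apply: ler_wpM2r (hA k).
  exact: cnorm_ge0.
by rewrite -mulr_sumr; apply: ler_wpM2l (hB c).
Qed.

Lemma col_boundB A B K L : col_bound A K -> col_bound B L -> col_bound (A - B) (K + L).
Proof.
move=> hA hB c; apply: le_trans (lerD (hA c) (hB c)); rewrite -big_split /=.
by apply: ler_sum => r _; rewrite !mxE -(cnormN (B r c)); exact: cnormD.
Qed.

Lemma col_boundZ A a K : col_bound A K -> col_bound (a *: A) (cnorm a * K).
Proof.
move=> hA c; apply: le_trans (ler_wpM2l (cnorm_ge0 a) (hA c)).
by rewrite mulr_sumr; apply: ler_sum => r _; rewrite mxE cnormM.
Qed.

Lemma col_bound_commx A B K L : 0 <= K -> 0 <= L -> col_bound A K -> col_bound B L ->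
  col_bound (commx A B) (2 * K * L).
Proof.
move=> K0 L0 hA hB; rewrite (_ : 2 * K * L = K * L + L * K); last by ring.
by apply: col_boundB; apply: col_boundM.
Qed.

(** Cauchy-Schwarz with weights |M r c|. Anti-Hermiticity equates row and column sums, and the
    vanishing of v and M v outside S lets only rows and columns in S enter. *)
Lemma schur_test M K (S : pred 'I_m) (v : 'cV[C]_m) : 0 <= K -> adj M = - M ->
  (forall c, S c -> \sum_r cnorm (M r c) <= K) ->
  (forall c, ~~ S c -> v c 0 = 0) -> (forall c, ~~ S c -> (M *m v) c 0 = 0) ->
  vnorm (M *m v) <= K * vnorm v.
Proof.
move=> K0 aM hM hv hMv.
have sym r c : cnorm (M r c) = cnorm (M c r).
  have := congr1 (fun A : 'M[C]_m => A r c) aM; rewrite /= adjE [RHS]mxE => E.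
  by rewrite -(cnormN (M r c)) -E cnormJ.
apply: ler_sqr_wp; first by rewrite mulr_ge0 ?vnorm_ge0.
rewrite exprMn !sqr_vnorm.
apply: (@le_trans _ _ (\sum_r K * \sum_c cnorm (M r c) * cnorm (v c 0) ^+ 2)).
  apply: ler_sum => r _.
  have s0 : 0 <= \sum_c cnorm (M r c) * cnorm (v c 0) ^+ 2.
    by apply: sumr_ge0 => c _; rewrite mulr_ge0 ?cnorm_ge0 ?sqr_ge0.
  case Sr: (S r); last by rewrite hMv ?Sr // cnorm0 expr0n mulr_ge0.
  pose f c := Num.sqrt (cnorm (M r c)).
  have ff c : f c ^+ 2 = cnorm (M r c) by rewrite sqr_sqrtr // cnorm_ge0.
  have := cauchy_schwarz_sum (index_enum 'I_m) xpredT f (fun c => f c * cnorm (v c 0)).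
  have -> : \sum_i f i * (f i * cnorm (v i 0)) = \sum_i cnorm (M r i) * cnorm (v i 0).
    by apply: eq_bigr => c _; rewrite mulrA -expr2 ff.
  have -> : \sum_i f i ^+ 2 = \sum_i cnorm (M r i) by apply: eq_bigr => c _.
  have -> : \sum_i (f i * cnorm (v i 0)) ^+ 2 = \sum_c cnorm (M r c) * cnorm (v c 0) ^+ 2.
    by apply: eq_bigr => c _; rewrite exprMn ff.
  move=> h.
  have r0 : 0 <= \sum_i cnorm (M r i) by apply: sumr_ge0 => i _; exact: cnorm_ge0.
  have rK : \sum_i cnorm (M r i) <= K.
    by under eq_bigr => c _ do rewrite sym; exact: hM.
  have h1 : cnorm ((M *m v) r 0) <= \sum_i cnorm (M r i) * cnorm (v i 0).
    rewrite mxE; apply: le_trans (cnorm_sum _ _ _) _.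
    by apply: ler_sum => c _; rewrite cnormM.
  apply: le_trans (ler_wpM2r s0 rK).
  rewrite -[X in _ <= X * _]sqr_sqrtr // -[X in _ <= _ * X]sqr_sqrtr // -exprMn.
  by rewrite lerXn2r ?nnegrE ?cnorm_ge0 ?mulr_ge0 ?sqrtr_ge0 // (le_trans h1).
rewrite -mulr_sumr exchange_big /= expr2 -mulrA; apply: ler_wpM2l => //.
rewrite mulr_sumr; apply: ler_sum => c _; rewrite -mulr_suml.
case Sc: (S c); last by rewrite hv ?Sc // cnorm0 expr0n !mulr0.
by apply: ler_wpM2r (hM c Sc); exact: sqr_ge0.
Qed.

End ColumnNorm.

(** * Local terms on orbitals and the sparse commutator bound *)

Section SparseInteractions.
Variable R : realType.
Local Notation C := (R[i]).
Variables (n eta d : nat) (tau nu : 'M[C]_n).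
Hypothesis sparse_tau : sparse d tau.
Hypothesis sparse_nu : sparse d nu.
Hypothesis herm_T : adj (Tham tau) = Tham tau.
Hypothesis herm_V : adj (Vham nu) = Vham nu.
Local Notation idx := 'I_(2 ^ n).
Implicit Types (j k x y : 'I_n) (b : bool) (r c : idx).

Definition local2 b j k : 'M[C]_(2 ^ n) :=
  (minus_i R * (if b then tau j k else nu j k)) *:
  (if b then bil R j k else Nop R j *m Nop R k).

Definition weight2 b j k : R := cnorm (if b then tau j k else nu j k).

Definition rate2 b : R := d%:R * (if b then max_norm tau else max_norm nu).

Lemma extsum_local2 b : extsum local2 b = hamZ tau nu b.
Proof.
rewrite /extsum /hamZ; case: b; rewrite scaler_sumr; apply: eq_bigr => j _;
by rewrite scaler_sumr; apply: eq_bigr => k _; rewrite /local2 scalerA.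
Qed.

Lemma col_bound_Adag j : col_bound (Adag R j) 1.
Proof.
move=> c; rewrite (bigD1 (flip j c)) //= big1 ?addr0 => [|r rc]; rewrite AdagE.
  by case: ifP => _; rewrite ?cnorm0 // /parity cnormX cnormN cnorm1 expr1n.
case: eqP => [E|]; last by rewrite andbF cnorm0.
by move: rc; rewrite E flipK eqxx.
Qed.

Lemma col_bound_Aop j : col_bound (Aop R j) 1.
Proof.
move=> c; rewrite (bigD1 (flip j c)) //= big1 ?addr0 => [|r rc]; rewrite AopE.
  by case: ifP => _; rewrite ?cnorm0 // /parity cnormX cnormN cnorm1 expr1n.
case: eqP => [E|]; last by rewrite andbF cnorm0.
by move: rc; rewrite E flipK eqxx.
Qed.

Lemma col_bound_bil j k : col_bound (bil R j k) 1.
Proof.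
rewrite -[1]mulr1; apply: col_boundM => //; [exact: col_bound_Adag|exact: col_bound_Aop].
Qed.

Lemma col_bound_local2 b j k : col_bound (local2 b j k) (weight2 b j k).
Proof.
rewrite -[weight2 b j k]mulr1 (_ : weight2 b j k =
  cnorm (minus_i R * (if b then tau j k else nu j k))); last first.
  by rewrite cnormM cnorm_minus_i mul1r.
apply: col_boundZ; case: b; first exact: col_bound_bil.
by rewrite -[1]mulr1; apply: col_boundM => //; exact: col_bound_bil.
Qed.

(* Killing all configurations which are empty on the support makes only the
   terms touching one of the eta occupied orbitals count in a column. *)
Definition kill2 (M : 'M[C]_(2 ^ n)) (S : {set 'I_n}) : Prop :=
  forall c, (forall x, x \in S -> ~~ bit c x) -> M *m delta_mx c (0 : 'I_1) = 0.

Lemma Aop_kill k c : ~~ bit c k -> Aop R k *m delta_mx c (0 : 'I_1) = 0.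
Proof.
move=> ck; rewrite -colE; apply/matrixP => r i; rewrite [LHS]mxE [RHS]mxE AopE.
case: eqP => [E|]; last by rewrite andbF.
by move: ck; rewrite E bit_flip eqxx addbT negbK => ->.
Qed.

Lemma kill2_local b j k : kill2 (local2 b j k) [set j; k].
Proof.
move=> c hc; rewrite /local2 -scalemxAl.
have ck : ~~ bit c k by apply: hc; rewrite set22.
suff -> : (if b then bil R j k else Nop R j *m Nop R k) *m delta_mx c (0 : 'I_1) = 0.
  by rewrite scaler0.
by case: b; rewrite /Nop /bil -!mulmxA Aop_kill ?mulmx0.
Qed.

Lemma kill2_commx b j k M S : kill2 M S ->
  kill2 (commx (local2 b j k) M) (S :|: [set j; k]).
Proof.
move=> hM c hc; rewrite /commx mulmxBl -!mulmxA.
rewrite (hM c) => [|x xS]; last by apply: hc; rewrite finset.in_setU xS.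
rewrite (@kill2_local b j k c) => [|x xS]; last by apply: hc; rewrite finset.in_setU xS orbT.
by rewrite !mulmx0 subrr.
Qed.

Lemma local2_comm b x y b' x' y' : [disjoint [set x; y] & [set x'; y']] ->
  commx (local2 b x y) (local2 b' x' y') = 0.
Proof.
move=> dj; apply: commx_eq0.
have sub z z' u u' : z \in [set x; y] -> z' \in [set x; y] ->
    u \in [set x'; y'] -> u' \in [set x'; y'] -> bil R z z' *m bil R u u' = bil R u u' *m bil R z z'.
  move=> hz hz' hu hu'; apply: bil_comm; apply: disjointWl (disjointWr _ dj).
    by apply/fintype.subsetP => w; rewrite in_set2 => /orP[] /eqP ->.
  by apply/fintype.subsetP => w; rewrite in_set2 => /orP[] /eqP ->.
have [x1 y1] := (set21 x y, set22 x y); have [x2 y2] := (set21 x' y', set22 x' y').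
case: b; case: b'; rewrite ?Nop_bil.
- exact: sub.
- by apply: comm_mx_mul; exact: sub.
- by apply/esym; apply: comm_mx_mul; apply/esym; exact: sub.
- by apply: comm_mx_mul; apply/esym; apply: comm_mx_mul; apply/esym; exact: sub.
Qed.

Lemma rate2_row b x : \sum_y weight2 b x y <= rate2 b.
Proof.
pose A := if b then tau else nu; have hA : sparse d A by rewrite /A; case: (b).
apply: (@le_trans _ _ (\sum_(y | A x y != 0) max_norm A)).
  rewrite [leRHS]big_mkcond; apply: ler_sum => y _.
  have -> : weight2 b x y = cnorm (A x y) by rewrite /A /weight2; case: (b).
  by case: eqP => [->|_]; rewrite ?cnorm0 //= max_norm_ub.
rewrite sumr_const -[leLHS]mulr_natl /rate2 (_ : (if b then max_norm tau else max_norm nu) = max_norm A); last by rewrite /A; case: (b).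
apply: ler_wpM2r; first exact: max_norm_ge0.
rewrite ler_nat; apply: leq_trans (proj1 hA x); apply/eq_leq/eq_card => z.
by apply/idP/idP => [h|/set_mem //]; exact: mem_set.
Qed.

Lemma rate2_col b y : \sum_x weight2 b x y <= rate2 b.
Proof.
pose A := if b then tau else nu; have hA : sparse d A by rewrite /A; case: (b).
apply: (@le_trans _ _ (\sum_(x | A x y != 0) max_norm A)).
  rewrite [leRHS]big_mkcond; apply: ler_sum => x _.
  have -> : weight2 b x y = cnorm (A x y) by rewrite /A /weight2; case: (b).
  by case: eqP => [->|_]; rewrite ?cnorm0 //= max_norm_ub.
rewrite sumr_const -[leLHS]mulr_natl /rate2 (_ : (if b then max_norm tau else max_norm nu) = max_norm A); last by rewrite /A; case: (b).
apply: ler_wpM2r; first exact: max_norm_ge0.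
rewrite ler_nat; apply: leq_trans (proj2 hA y); apply/eq_leq/eq_card => z.
by apply/idP/idP => [h|/set_mem //]; exact: mem_set.
Qed.

Lemma anti_hamZ b : adj (hamZ tau nu b) = - hamZ tau nu b.
Proof.
rewrite /hamZ adjZ; have -> : adj (if b then Tham tau else Vham nu) =
  (if b then Tham tau else Vham nu) by case: b.
rewrite -scaleNr; congr (_ *: _); rewrite /minus_i rmorphN; congr (- _).
by apply/eqP; rewrite eq_complex /= oppr0 !eqxx.
Qed.

(** Commutators of anti-Hermitian matrices are anti-Hermitian, so column sums alone can feed the
    Schur test. *)
Lemma anti_adw u b : adj (adw (hamZ tau nu) u (hamZ tau nu b)) =
  - adw (hamZ tau nu) u (hamZ tau nu b).
Proof.
elim: u => [|c u IH] /=; first exact: anti_hamZ.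
by rewrite /commx adjB !adjM IH anti_hamZ !mulmxN !mulNmx !opprK opprB.
Qed.

Lemma col_sum_adw2 u b c : occ_num n c = eta ->
  \sum_r cnorm (adw (hamZ tau nu) u (hamZ tau nu b) r c) <=
  eta%:R * (cst_local R (size u) * (\prod_(e <- u) rate2 e) * rate2 b).
Proof.
move=> occ.
have w0 e x y : 0 <= weight2 e x y by exact: cnorm_ge0.
have [l [E hl hD]] := local_sum_adw w0 col_bound_local2 (@col_bound_commx R (2 ^ n))
  kill2_local kill2_commx local2_comm rate2_row rate2_col u b.
have -> : adw (hamZ tau nu) u (hamZ tau nu b) = \sum_(s <- l) s.1.
  rewrite -E -extsum_local2; elim: (u) => //= e u' ->.
  by rewrite (extsum_local2 e).
set D := _ * _ * _ in hD *.
have nn : {in l, forall s, 0 <= s.2.2} by move=> s /hl /lt_ge0.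
pose O := [set x : 'I_n | bit c x].
have cO : #|O| = eta.
  rewrite -occ occ_numE -sum1_card big_mkcond /=; apply: eq_bigr => x _.
  by rewrite inE; case: (bit c x).
have := @sum_touching R 'I_n _ l (fun s => s.2.1) (fun s => s.2.2) O D nn hD.
rewrite cO; apply: le_trans.
apply: (@le_trans _ _ (\sum_(s <- l) \sum_r cnorm (s.1 r c))).
  rewrite exchange_big /=; apply: ler_sum => r _; rewrite summxE.
  exact: cnorm_sum.
rewrite big_seq [leRHS]big_mkcond [leRHS]big_seq; apply: ler_sum => s sl.
case: ifPn => [_|]; first exact: (lt_nb (hl s sl)).
rewrite negbK => dj; rewrite big1 // => r _.
have := lt_kill (hl s sl) c; rewrite -colE => h.
have /matrixP/(_ r 0) : col c s.1 = 0.
  by apply: h => x xS; have := disjointFr dj xS; rewrite inE => ->.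
by rewrite !mxE => ->; rewrite cnorm0.
Qed.

Lemma opb_adw_hamZ2 u b : opb (sector_proj R n eta) (adw (hamZ tau nu) u (hamZ tau nu b))
  (eta%:R * (cst_local R (size u) * (\prod_(e <- u) rate2 e) * rate2 b)).
Proof.
set K := _ * _; set M := adw _ _ _.
have K0 : 0 <= K.
  have r0 e : 0 <= rate2 e.
    by rewrite mulr_ge0 ?ler0n //; case: e; exact: max_norm_ge0.
  apply: mulr_ge0; first exact: ler0n.
  by apply: mulr_ge0 => //; apply: mulr_ge0; [exact: cst_local_ge0|exact: prodr_ge0].
have Zcomm e : sector_proj R n eta *m hamZ tau nu e = hamZ tau nu e *m sector_proj R n eta.
  by apply: comm_mx_scale; case: e; [exact: sector_proj_T|exact: sector_proj_V].
have PM : sector_proj R n eta *m M = M *m sector_proj R n eta.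
  rewrite /M; elim: (u) => [|e u' IH] /=; first exact: Zcomm.
  exact: comm_mx_commx.
move=> v Pv; have hv : in_sector eta v by apply/sector_projP.
have hMv : in_sector eta (M *m v) by apply/sector_projP; rewrite mulmxA PM -mulmxA Pv.
apply: (schur_test (S := fun c : idx => occ_num n c == eta)) => //.
- exact: anti_adw.
- by move=> c /eqP; exact: col_sum_adw2.
Qed.

End SparseInteractions.

(** * From commutator bounds to the seminorm estimates *)

Section Conclusion.
Variable R : realType.
Local Notation C := (R[i]).

(** The innermost commutator vanishes if its two letters agree. Otherwise they contribute one rate
    of each kind, and each of the p outer letters contributes at most the sum of the rates. *)
Lemma opb_adw_mixed m (P : 'M[C]_m) (Z : bool -> 'M[C]_m) (rate : bool -> R) (K : R) p :
  0 <= K -> (forall b, 0 <= rate b) ->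
  (forall u b, size u = p.+1 ->
     opb P (adw Z u (Z b)) (K * ((\prod_(c <- u) rate c) * rate b))) ->
  forall u b, size u = p.+1 -> opb P (adw Z u (Z b))
    (K * (rate true * rate false * (rate true + rate false) ^+ p)).
Proof.
move=> K0 r0 h u b; case/lastP: u => // u c; rewrite size_rcons => -[su].
have s0 : 0 <= rate true + rate false by rewrite addr_ge0.
have rhs0 : 0 <= K * (rate true * rate false * (rate true + rate false) ^+ p).
  by rewrite !mulr_ge0 ?exprn_ge0.
have [->|cb] := eqVneq c b; first by rewrite adw_rcons commxx adw0; exact: opb0.
apply: opb_le (h _ _ _); last by rewrite size_rcons su.
apply: ler_wpM2l => //; rewrite -cats1 big_cat big_seq1 /=.
have hu : \prod_(i <- u) rate i <= (rate true + rate false) ^+ p.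
  rewrite -su; elim: (u) => [|e u' IH]; first by rewrite big_nil.
  rewrite big_cons /= exprS ler_pM ?prodr_ge0 //.
  by case: (e); rewrite ?lerDl ?lerDr.
have -> : (\prod_(i <- u) rate i) * rate c * rate b = rate true * rate false * \prod_(i <- u) rate i.
  by case: (c) (b) cb => [] [] //= _; ring.
by apply: ler_wpM2l; rewrite ?mulr_ge0.
Qed.

Lemma eta_seminorm_le n eta (X : 'M[C]_(2 ^ n)) K : 0 <= K ->
  opb (sector_proj R n eta) X K -> eta_seminorm eta X <= K.
Proof.
move=> K0 hX; rewrite /eta_seminorm; set S := (X in sup X).
(* The supremum of the empty set is 0 by convention. *)
have [->|S0] := eqVneq S classical_sets.set0; first by rewrite sup0.
apply: ge_sup; first exact/set0P.
move=> _ [phi [psi [[phi1 _] [psi1 hpsi] ->]]].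
rewrite -mulmxA; apply: le_trans (cnorm_dot _ _) _; rewrite phi1 mul1r.
have := hX psi; rewrite psi1 mulr1; apply.
by apply/sector_projP.
Qed.

Definition formula_list (Y : nat) (a b : 'I_Y -> R) : seq (R * bool) :=
  flatten [seq [:: (a u, true); (b u, false)] | u <- index_enum 'I_Y].

Lemma evolE m (s c : R) (X : 'M[C]_m) :
  evol (s * c) X = expt (c%:C%C *: (minus_i R *: X)) s.
Proof.
rewrite expt_expm /evol scalerA scalerA.
suff -> : s%:C%C * c%:C%C * minus_i R = - ('i%C * (s * c)%:C%C) by [].
by rewrite rmorphM /minus_i mulrN [in LHS]mulrC.
Qed.

Lemma prod_formulaE (Y : nat) (a b : 'I_Y -> R) n (tau nu : 'M[C]_n) t :
  prod_formula a b (Tham tau) (Vham nu) t = prodl (hamZ tau nu) (formula_list a b) t.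
Proof.
rewrite /prod_formula /formula_list; elim: (index_enum _) => [|u r IH].
  by rewrite big_nil.
rewrite big_cons IH !evolE; exact/esym/mulmxA.
Qed.

Lemma evol_sumE n (tau nu : 'M[C]_n) t :
  evol t (Tham tau + Vham nu) = expt (hamZ tau nu true + hamZ tau nu false) t.
Proof.
by rewrite -[t in LHS]mulr1 evolE rmorph1 scale1r scalerDr.
Qed.

Lemma formula_error (p Y : nat) (a b : 'I_Y -> R) n (tau nu : 'M[C]_n) eta
    (rate : bool -> R) (K t : R) :
  is_order p.+1 a b -> adj (Tham tau) = Tham tau -> adj (Vham nu) = Vham nu ->
  0 <= K -> (forall c, 0 <= rate c) -> 0 <= t ->
  (forall u c, size u = p.+1 -> opb (sector_proj R n eta)
     (adw (hamZ tau nu) u (hamZ tau nu c)) (K * ((\prod_(e <- u) rate e) * rate c))) ->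
  eta_seminorm eta (prod_formula a b (Tham tau) (Vham nu) t - evol t (Tham tau + Vham nu))
  <= cstrem p.+1 (formula_list a b) *
     (K * (rate true * rate false * (rate true + rate false) ^+ p)) * t ^+ p.+2.
Proof.
move=> ord hT hV K0 r0 t0 hw.
have anti := anti_hamZ hT hV.
have K'0 : 0 <= K * (rate true * rate false * (rate true + rate false) ^+ p).
  by rewrite !mulr_ge0 ?exprn_ge0 ?addr_ge0.
apply: eta_seminorm_le.
  apply: mulr_ge0; last exact: exprn_ge0.
  by apply: mulr_ge0 => //; exact: cstrem_ge0.
rewrite prod_formulaE evol_sumE; apply: trotter_error => //.
- by move=> e; apply: comm_mx_scale; case: e; [exact: sector_proj_T|exact: sector_proj_V].
- exact: opb_adw_mixed.
(* K1 and delta depend on n, tau and nu; they are consumed by [genq_vanish], whose conclusion is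
   exact, and leave no trace in the bound. *)
have [K1 [delta [d0 hO]]] := ord _ (Tham tau) (Vham nu).
apply: (genq_vanish (K := (2 ^ n)%:R ^+ 2 * `|K1|) anti d0) => s /andP[s0 sd].
rewrite -mulrA; apply: opb_entries => [|i j]; first by rewrite mulr_ge0 ?exprn_ge0.
rewrite -prod_formulaE -evol_sumE.
apply: le_trans (hO s _ i j) _; rewrite ger0_norm //.
by apply: ler_wpM2r (ler_norm _); exact: exprn_ge0.
Qed.

End Conclusion.

Theorem theorem1 (R : realType) (p Y : nat) (a b : 'I_Y -> R) :
  (1 <= p)%N -> is_order p a b ->
  exists C1 C2 : R, 0 < C1 /\ 0 < C2 /\
  (forall (n : nat) (tau nu : 'M[R[i]]_n) (eta : nat) (t : R),
     (1 <= n)%N -> adj (Tham tau) = Tham tau -> adj (Vham nu) = Vham nu ->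
     (eta <= n)%N -> 0 <= t ->
     eta_seminorm eta (prod_formula a b (Tham tau) (Vham nu) t
                       - evol t (Tham tau + Vham nu))
     <= C1 * (spec_norm tau + max_norm nu * eta%:R) ^+ (p - 1)
           * spec_norm tau * max_norm nu * eta%:R ^+ 2 * t ^+ p.+1) /\
  (forall (n : nat) (tau nu : 'M[R[i]]_n) (eta d : nat) (t : R),
     (1 <= n)%N -> adj (Tham tau) = Tham tau -> adj (Vham nu) = Vham nu ->
     (eta <= n)%N -> 0 <= t ->
     sparse d tau -> sparse d nu ->
     eta_seminorm eta (prod_formula a b (Tham tau) (Vham nu) t
                       - evol t (Tham tau + Vham nu))
     <= C2 * (max_norm tau + max_norm nu) ^+ (p - 1)
           * max_norm tau * max_norm nu * d%:R ^+ p.+1 * eta%:R * t ^+ p.+1).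
Proof.
case: p => // p _ ord; rewrite subn1 /=.
pose c0 := cstrem p.+1 (formula_list a b) * cst_local R p.+1.
have c00 : 0 <= c0 by rewrite mulr_ge0 ?cstrem_ge0 ?cst_local_ge0.
(* Adding 1 secures strict positivity, as c0 is only known to be nonnegative. *)
have c1 : 0 < c0 + 1 by rewrite ltr_wpDl.
have cc : c0 <= c0 + 1 by rewrite lerDl.
exists (c0 + 1), (c0 + 1); do 2 split=> //; split.
  move=> n tau nu eta t n1 hT hV en t0.
  have s0 : 0 <= spec_norm tau by exact: spec_tau_ge0.
  have m0 := max_norm_ge0 nu.
  apply: le_trans (@formula_error R p Y a b n tau nu eta (rate1 eta tau nu)
    (eta%:R * cst_local R p.+1) t ord hT hV _ _ t0 _) _.
  - by rewrite mulr_ge0 ?ler0n ?cst_local_ge0.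
  - by case; rewrite /rate1 ?mulr_ge0 ?ler0n.
  - move=> u c su; have := opb_adw_hamZ1 tau nu n1 u c (eta := eta).
    by rewrite su !mulrA.
  (* One eta counts the sites and the other sits in the rate of V, which together give eta^2. *)
  rewrite /rate1.
  pose G := (spec_norm tau + max_norm nu * eta%:R) ^+ p
    * spec_norm tau * max_norm nu * eta%:R ^+ 2 * t ^+ p.+2.
  have G0 : 0 <= G.
    do 2 (apply: mulr_ge0; last by rewrite exprn_ge0 ?ler0n).
    do 2 (apply: mulr_ge0 => //).
    by apply: exprn_ge0; apply: addr_ge0 => //; rewrite mulr_ge0 ?ler0n.
  rewrite [leRHS](_ : _ = (c0 + 1) * G); last by rewrite /G !mulrA.
  apply: le_trans (ler_wpM2r G0 cc); rewrite le_eqVlt; apply/orP; left; apply/eqP.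
  by rewrite /G /c0; ring.
move=> n tau nu eta d t n1 hT hV en t0 st sn.
have s0 := max_norm_ge0 tau; have m0 := max_norm_ge0 nu.
apply: le_trans (@formula_error R p Y a b n tau nu eta (rate2 d tau nu)
  (eta%:R * cst_local R p.+1) t ord hT hV _ _ t0 _) _.
- by rewrite mulr_ge0 ?ler0n ?cst_local_ge0.
- by case; rewrite /rate2 mulr_ge0 ?ler0n.
- move=> u c su; have := opb_adw_hamZ2 st sn hT hV u c (eta := eta).
  by rewrite su !mulrA.
rewrite /rate2.
pose G := (max_norm tau + max_norm nu) ^+ p
  * max_norm tau * max_norm nu * d%:R ^+ p.+2 * eta%:R * t ^+ p.+2.
have G0 : 0 <= G.
  apply: mulr_ge0; last exact: exprn_ge0.
  apply: mulr_ge0; last exact: ler0n.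
  apply: mulr_ge0; last by rewrite exprn_ge0 ?ler0n.
  do 2 (apply: mulr_ge0 => //).
  by apply: exprn_ge0; apply: addr_ge0.
rewrite [leRHS](_ : _ = (c0 + 1) * G); last by rewrite /G !mulrA.
apply: le_trans (ler_wpM2r G0 cc); rewrite le_eqVlt; apply/orP; left; apply/eqP.
(* With p now the order minus one, each of the p + 2 letters carries a factor d: two from the mixed
   innermost pair and p from the power of the sum. *)
rewrite /G /c0 (_ : _ + _ = d%:R * (max_norm tau + max_norm nu)); last by rewrite mulrDr.
by rewrite exprMn (exprS d%:R) (exprS d%:R p); ring.
Qed.
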